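(* Let $A,B,C,D$ be the consecutive vertices of a convex quadrilateral, let $V$ be the intersection point of its diagonals $AC$ and $BD$, and consider the concave (diagonal) pentagon $ABCDV$. Let $\vec u=\frac{B-A}{|B-A|}$, and for a point $M$ of the segment $AB$ let $op(M)$ be the point of the segment $CD$ such that the straight line through $M$ and $op(M)$ contains $V$. Then, for almost every $\ell>0$, $$\int_0^{|B-A|}da\;\rho'_2\big(A+a\vec u,\,A+a\vec u,\,C,\,op(A+a\vec u);\ell\big)=\rho_{conc}(AB,CD)(\ell),$$ where $\rho'_2$ is the partial derivative of $\rho(P,P',Q,Q';\ell)$ with respect to its second argument along $AB$, that is, $$\rho'_2(P,P,Q,Q';\ell)=\lim_{t\to0^+}\frac1t\,\rho(P,P+t\vec u,Q,Q';\ell).$$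
   Context: $\mu$ is the translation- and rotation-invariant measure on straight lines of the plane, normalized as $d\mu=dp\,d\theta$ ($\theta\in[0,\pi)$ the direction of the line, $p$ its signed distance to the origin). A chord joining two segments is the piece of a straight line meeting both segments comprised between its intersection points with them; its length is the distance between those two points, and sets of chords carry the measure $\mu$ of the corresponding lines. The density of measure of the length of a set of chords is the function whose integral over any Borel set $E\subset(0,\infty)$ is the $\mu$-measure of the chords of the set with length in $E$. For points $P,P',Q,Q'$, $\rho(P,P',Q,Q';\ell)$ denotes the density of measure, at $\ell$, of the length of the chords joining the segments $PP'$ and $QQ'$ (it is $0$ if one of the segments reduces to a point); it is taken to be the version that is continuous in $\ell\in(0,\infty)$, or continuous on $(0,\infty)\setminus\{d\}$ if the segments are parallel with supporting lines at distance $d$. $\rho_{conc}(AB,CD)(\ell)$ denotes the density of measure of the length of those chords joining the segments $AB$ and $CD$ which are contained in the pentagon $ABCDV$ (the simple polygon with consecutive vertices $A,B,C,D,V$ and reflex vertex $V$), i.e. those passing $V$ on the same side as the segment $BC$. For given $\ell$ the integrand is understood to be defined for almost every $a$. *)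

(* Defs.v *)
From HB Require Import structures.
From mathcomp Require Import all_boot all_order all_algebra.
From mathcomp Require Import all_classical all_reals all_analysis.

Set Implicit Arguments.
Unset Strict Implicit.
Unset Printing Implicit Defensive.

Import Order.TTheory GRing.Theory Num.Theory.
Import numFieldNormedType.Exports.

Local Open Scope classical_set_scope.
Local Open Scope ring_scope.

(* Points of the plane are pairs of reals; the library norm on [R * R] is the
   sup norm, hence the separate Euclidean distance. *)
Definition eucl_dist (R : realType) (P Q : R * R) : R :=
  Num.sqrt ((Q.1 - P.1) ^+ 2 + (Q.2 - P.2) ^+ 2).

Definition cross (R : realType) (u v : R * R) : R := u.1 * v.2 - u.2 * v.1.

Definition segment (R : realType) (P Q : R * R) : set (R * R) :=
  [set M | exists2 t : R, 0 <= t <= 1 & M = P + t *: (Q - P)].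

Definition line_through (R : realType) (P Q : R * R) : set (R * R) :=
  [set M | exists t : R, M = P + t *: (Q - P)].

Definition triangle (R : realType) (P Q S : R * R) : set (R * R) :=
  [set M | exists a b c : R, [/\ 0 <= a, 0 <= b, 0 <= c, a + b + c = 1 &
                                M = a *: P + b *: Q + c *: S]].

(* M and N lie strictly on the same side of the line PQ. *)
Definition same_side (R : realType) (P Q M N : R * R) : Prop :=
  0 < cross (Q - P) (M - P) * cross (Q - P) (N - P).

Definition convex_quadrilateral (R : realType) (A B C D : R * R) : Prop :=
  [/\ same_side A B C D, same_side B C D A,
      same_side C D A B & same_side D A B C].

(* The closed region bounded by the simple polygon ABCDV when V is the
   intersection point of the diagonals of the convex quadrilateral ABCD: this
   region is star-shaped with respect to V, and the sides DV and VA issue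
   from V. *)
Definition pentagon (R : realType) (A B C D V : R * R) : set (R * R) :=
  triangle A B V `|` triangle B C V `|` triangle C D V.

(* The line with coordinates (p, theta): its direction vector is
   (cos theta, sin theta), and p is its signed distance to the origin, measured
   along the normal (- sin theta, cos theta). *)
Definition line (R : realType) (l : R * R) : set (R * R) :=
  [set M | M.2 * cos l.2 - M.1 * sin l.2 = l.1].

(* The measure dp dtheta, theta in [0, pi[, on sets of line coordinates. *)
Definition line_measure (R : realType) (L : set (R * R)) : \bar R :=
  (lebesgue_measure \x lebesgue_measure)%E
    (L `&` [set l | 0 <= l.2 < pi]).

(* [chord l P P' Q Q' M N]: MN is the chord cut on the line l by the segments
   PP' and QQ'.  M and N are unique except when l contains PP' or QQ'. *)
Definition chord (R : realType) (l P P' Q Q' M N : R * R) : Prop :=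
  [/\ segment P P' M, segment Q Q' N, line l M & line l N].

Definition chords (R : realType) (P P' Q Q' : R * R) (E : set R) :
    set (R * R) :=
  [set l | exists M N, chord l P P' Q Q' M N /\ E (eucl_dist M N)].

Definition chords_in (R : realType) (K : set (R * R)) (P P' Q Q' : R * R)
    (E : set R) : set (R * R) :=
  [set l | exists M N, [/\ chord l P P' Q Q' M N, segment M N `<=` K &
                          E (eucl_dist M N)]].

(* f is a density of measure of the length of a set of chords, where L E is the
   set of the lines whose chord has its length in E. *)
Definition length_density (R : realType) (L : set R -> set (R * R))
    (f : R -> R) : Prop :=
  measurable_fun (`]0, +oo[ : set R) f /\
  forall E : set R, measurable E -> E `<=` `]0, +oo[ ->
    (\int[lebesgue_measure]_(x in E) (f x)%:E)%E = line_measure (L E).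

Definition parallel (R : realType) (P P' Q Q' : R * R) : Prop :=
  cross (P' - P) (Q' - Q) = 0.

(* The distance from the point Q to the line PP'. *)
Definition line_dist (R : realType) (P P' Q : R * R) : R :=
  `|cross (P' - P) (Q - P)| / eucl_dist P P'.

Definition continuous_density (R : realType) (P P' Q Q' : R * R)
    (f : R -> R) : Prop :=
  forall l : R, 0 < l -> (parallel P P' Q Q' -> l <> line_dist P P' Q) ->
    {for l, continuous f}.

(* [rho] and [rho_conc] select a density satisfying the stated conditions; such
   densities exist.  The conditions determine [rho] on ]0, +oo[, except at the
   distance of the supporting lines of parallel segments, and [rho_conc] almost
   everywhere on ]0, +oo[. *)
Definition rho (R : realType) (P P' Q Q' : R * R) : R -> R :=
  if (P == P') || (Q == Q') then cst 0
  else xget (cst 0) [set f | length_density (chords P P' Q Q') f /\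
                             continuous_density P P' Q Q' f].

Definition rho_conc (R : realType) (A B C D V : R * R) : R -> R :=
  xget (cst 0)
    [set f | length_density (chords_in (pentagon A B C D V) A B C D) f].

Definition rho2_quotient (R : realType) (u P Q Q' : R * R) (l t : R) : R :=
  t^-1 * rho P (P + t *: u) Q Q' l.

(* rho'_2(P, P, Q, Q'; l) along u; meaningful when the limit exists. *)
Definition rho2 (R : realType) (u P Q Q' : R * R) (l : R) : R :=
  lim (rho2_quotient u P Q Q' l t @[t --> 0^'+]).

(* Main.v *)
Require Import Defs.
From HB Require Import structures.
From mathcomp Require Import all_boot all_order all_algebra.
From mathcomp Require Import all_classical all_reals all_analysis.
From mathcomp Require Import measurable_realfun ring lra.

Set Implicit Arguments.
Unset Strict Implicit.
Unset Printing Implicit Defensive.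

Import Order.TTheory GRing.Theory Num.Theory.
Import numFieldNormedType.Exports HBNNSimple.

Local Open Scope classical_set_scope.
Local Open Scope ring_scope.

(** Put on the lines [AB] and [CD] the abscissas [s] and [r], measured from [A]
    and from [C] along unit vectors [u] and [w]; [M = A + s u], [N = C + r w] and
    [v = N - M]. The idea is that every density of the statement is the integral
    over [s] of one explicit kernel, so that differentiating with respect to the
    end of the first segment just evaluates this kernel.

    A line meeting both supporting lines transversally is determined by [(s, r)],
    and there [dp dtheta] becomes [|v x u| |v x w| / |v|^3 ds dr]
    ([line_measure_joining]). For a fixed [s] one then replaces [r] by the length
    [l = |v|]: the circle of radius [l] around [M] cuts the line [CD] in the two
    points at abscissas [foot s +- sqrt (l^2 - height s^2)], so that a set of
    chords given by a set [T] of pairs [(s, r)] has the length density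
    [l |-> int chord_kernel T s l ds] ([line_measure_kernel]), where
    [chord_kernel T s l] adds [|v x u| |height s| / (l^2 sqrt (l^2 - height s^2))]
    over those of the two points whose abscissa [r] satisfies [T (s, r)]. This
    treats parallel and secant lines alike.

    For the chords joining [PP'] with [P = A + a u], [P' = P + t u] to the segment
    from [C] to [C + b w], the integral of the kernel over [a <= s <= a + t] is a
    continuous function of [l], except at the distance of parallel lines
    ([continuous_chord_integral]); it is therefore [rho] itself ([rhoE]), and its
    right derivative at [t = 0] is the kernel at [s = a], provided that the kernel
    is continuous there ([cvg_mean_kernel]).

    On the other side, a chord [MN] stays in the pentagon iff [N] lies between [C]
    and [op M] ([chord_in_pentagonP]); hence [rho_conc] is the integral over [s]
    of the kernel of the segment from [C] to [op (A + s u)], which is exactly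
    [rho'_2] at [s]. The kernel fails to be continuous only where [l] is the
    distance from [M] to the line [CD], to [C] or to [op M]. These are polynomial
    equations in [s], and for all but finitely many [l] they have finitely many
    solutions, which affect neither integrals nor measurability. *)

(** * Change of variables in the Lebesgue integral *)

Section weighted_image.
Context d d' (T : measurableType d) (T' : measurableType d') (R : realType).
Variables (m : {measure set T -> \bar R}) (K : set T).
Variables (phi : T -> T') (h : T -> R).
Hypotheses (mK : measurable K) (mphi : measurable_fun K phi).
Hypotheses (mh : measurable_fun K h) (h0 : forall x, K x -> 0 <= h x).
Local Open Scope ereal_scope.

(** The image under [phi] of the restriction to [K] of the measure with density
    [h]. The hypotheses are arguments in order that the structure of measure can
    be attached to the definition. *)
Definition weighted_image (_ : measurable K) (_ : measurable_fun K phi)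
    (_ : measurable_fun K h) (_ : forall x, K x -> (0 <= h x)%R) (B : set T') :=
  \int[m]_(x in K `&` phi @^-1` B) (h x)%:E.

Local Notation nu := (weighted_image mK mphi mh h0).

Let nu0 : nu set0 = 0.
Proof. by rewrite /weighted_image preimage_set0 setI0 integral_set0. Qed.

Let nu_ge0 B : 0 <= nu B.
Proof. by apply: integral_ge0 => x [Kx _]; rewrite lee_fin h0. Qed.

Let nu_sigma_additive : semi_sigma_additive nu.
Proof.
move=> F mF tF mUF; rewrite /weighted_image preimage_bigcup setI_bigcupr.
rewrite ge0_integral_bigcup//=.
- apply: is_cvg_ereal_nneg_natsum_cond => n _ _.
  by apply: integral_ge0 => x [Kx _]; rewrite lee_fin h0.
- by move=> n; exact: mphi.
- apply/measurable_EFinP; apply: measurable_funS mh => //.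
  by move=> x [n _ []].
- by move=> x [n _ [Kx _]]; rewrite lee_fin h0.
- apply/trivIsetP => i j _ _ ij; rewrite setIACA setIid -preimage_setI.
  by move/trivIsetP : tF => /(_ _ _ _ _ ij) ->//; rewrite preimage_set0 setI0.
Qed.

HB.instance Definition _ :=
  isMeasure.Build _ _ _ nu nu0 nu_ge0 nu_sigma_additive.

(** An equality of measures is an equality of integrals of indicators; it passes
    to simple functions, then to monotone limits. *)
Lemma ge0_integral_weighted_image (m' : {measure set T' -> \bar R})
    (f : T' -> \bar R) :
  (forall B, measurable B -> nu B = m' B) ->
  measurable_fun setT f -> (forall y, 0 <= f y) ->
  \int[m]_(x in K) (f (phi x) * (h x)%:E) = \int[m']_y f y.
Proof.
move=> num' mf f0.
have mhE : measurable_fun K (EFin \o h) by exact/measurable_EFinP.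
pose g := nnsfun_approx measurableT mf.
have mg n : measurable_fun K (fun x => (g n (phi x))%:E * (h x)%:E).
  apply: emeasurable_funM => //; apply/measurable_EFinP.
  exact: measurableT_comp.
have indicE (B : set T') : measurable B ->
    \int[m]_(x in K) ((\1_B (phi x))%:E * (h x)%:E) = m' B.
  move=> mB; rewrite -num'// /weighted_image integral_mkcondr.
  apply: eq_integral => x _; rewrite /= patchE indicE.
  have [xB|xB] := boolP (phi x \in B).
    by rewrite mul1e ifT//; rewrite inE in xB; exact/mem_set.
  by rewrite mul0e ifF//; apply: contraNF xB; rewrite !inE.
have simpleE n : \int[m]_(x in K) ((g n (phi x))%:E * (h x)%:E) =
    \int[m']_y (g n y)%:E.
  rewrite integralT_nnsfun sintegralE.
  transitivity (\int[m]_(x in K) (\sum_(y \in range (g n))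
      (y%:E * ((\1_(g n @^-1` [set y]) (phi x))%:E * (h x)%:E)))).
    apply: eq_integral => x _; rewrite fimfunE -fsumEFin// ge0_mule_fsuml.
      by apply: eq_fsbigr => y _; rewrite EFinM muleA.
    by move=> y; rewrite lee_fin; exact: nnfun_muleindic_ge0.
  rewrite ge0_integral_fsum//; last 2 first.
  - move=> y; apply: measurable_funeM; apply: emeasurable_funM => //.
    by apply/measurable_EFinP; exact: measurableT_comp.
  - move=> y x Kx; rewrite muleA; apply: mule_ge0; last by rewrite lee_fin h0.
    exact: nnfun_muleindic_ge0.
  apply: eq_fsbigr => y /[!inE] -[z _ <-].
  rewrite ge0_integralZl//.
  - by rewrite indicE//; exact: measurable_funPTI.
  - apply: emeasurable_funM => //; apply/measurable_EFinP.
    exact: measurableT_comp.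
  - by move=> x Kx; rewrite mule_ge0// lee_fin h0.
  - by rewrite lee_fin.
transitivity (limn (fun n => \int[m]_(x in K) ((g n (phi x))%:E * (h x)%:E))).
  rewrite -monotone_convergence//.
  - apply: eq_integral => x /[!inE] Kx; apply/esym/cvg_lim => //.
    rewrite muleC; under eq_fun do rewrite muleC.
    by apply: cvgeZl => //; exact: cvg_nnsfun_approx.
  - by move=> n x Kx; rewrite mule_ge0// lee_fin ?h0.
  - move=> x Kx a b ab; rewrite lee_pmul ?lee_fin ?h0//.
    exact/lefP/nd_nnsfun_approx.
rewrite (funext simpleE) -monotone_convergence//.
- by apply: eq_integral => x _; apply/cvg_lim => //; exact: cvg_nnsfun_approx.
- by move=> n; exact/measurable_EFinP.
- by move=> n x _; rewrite lee_fin.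
- by move=> x _ a b ab; rewrite lee_fin; exact/lefP/nd_nnsfun_approx.
Qed.

End weighted_image.

Section change_of_variables.
Context {R : realType}.
Notation mu := (@lebesgue_measure R).
Implicit Types (phi dphi : R -> R) (f : R -> \bar R).

(** Closed rays are stable under intersection and generate the Borel sets. *)
Lemma lebesgue_eq_on_rays (m1 m2 : {measure set (measurableTypeR R) -> \bar R}) :
  (m1 setT < +oo)%E ->
  (forall x, m1 `[x, +oo[%classic = m2 `[x, +oo[%classic) ->
  forall B, measurable B -> m1 B = m2 B.
Proof.
move=> fin1 eq12 B mB.
have H := @measure_unique _ R (measurableTypeR R) (@RGenCInfty.G R)
  (fun n => `[- n%:R, +oo[%classic) _ _ _ _ m1 m2 _ _ B mB.
apply: H => //.
- exact: RGenCInfty.measurableE.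
- move=> _ _ [x ->] [y ->]; exists (Num.max x y).
  apply/seteqP; split => z /=; rewrite !in_itv/= !andbT ge_max.
    by move=> [-> ->].
  by move=> /andP[].
- by move=> n; exists (- n%:R).
- apply/seteqP; split=> // x _; exists (Num.truncn `|x|).+1 => //=.
  rewrite in_itv/= andbT lerNl (le_trans (ler_norm _))// normrN.
  exact/ltW/truncnS_gt.
- by move=> _ [x ->]; exact: eq12.
- move=> n; apply: le_lt_trans fin1; apply: le_measure => //; rewrite inE//.
Qed.

(** By the fundamental theorem of calculus the image of [dphi x dx] and the
    Lebesgue measure give the same mass to the trace of every ray. *)
Lemma ge0_integral_segment_image phi dphi (a b : R) f : a < b ->
  (forall x, a <= x <= b -> is_derive x 1 phi (dphi x)) ->
  (forall x, a <= x <= b -> {for x, continuous dphi}) ->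
  (forall x, a <= x <= b -> 0 < dphi x) ->
  measurable_fun setT f -> (forall y, 0 <= f y)%E ->
  (\int[mu]_(x in `[a, b]) (f (phi x) * (dphi x)%:E) =
   \int[mu]_(y in `[phi a, phi b]) f y)%E.
Proof.
move=> ab dphiP cdphi dphi0 mf f0.
have cphi x : a <= x <= b -> {for x, continuous phi}.
  move=> xab; apply/differentiable_continuous; rewrite -derivable1_diffP.
  by have [] := dphiP _ xab.
have cphiab x y : a <= x -> y <= b -> {within `[x, y], continuous phi}.
  move=> ax yb; apply: continuous_in_subspaceT => z.
  by rewrite inE/= in_itv/= => /andP[xz zy]; apply: cphi; lra.
have cdphiab x y : a <= x -> y <= b -> {within `[x, y], continuous dphi}.
  move=> ax yb; apply: continuous_in_subspaceT => z.
  by rewrite inE/= in_itv/= => /andP[xz zy]; apply: cdphi; lra.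
have phi_lt : {in `[a, b]%R &, {homo phi : x y / x < y}}.
  apply: gtr0_derive1_lt_cc; last exact: cphiab.
    by move=> x; rewrite in_itv/= => /andP[/ltW ax /ltW xb];
       have [] := dphiP x; rewrite ?ax ?xb.
  move=> x; rewrite in_itv/= => /andP[/ltW ax /ltW xb].
  have xab : a <= x <= b by rewrite ax xb.
  by rewrite derive1E; have [_ ->] := dphiP _ xab; exact: dphi0.
have phi_le x y : a <= x -> x <= y -> y <= b -> phi x <= phi y.
  move=> ax; rewrite le_eqVlt => /predU1P[->//|xy yb].
  by apply/ltW/phi_lt => //; rewrite in_itv/=; lra.
have mphi : measurable_fun (`[a, b] : set R) phi.
  by apply: subspace_continuous_measurable_fun => //; exact: cphiab.
have mdphi : measurable_fun (`[a, b] : set R) dphi.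
  by apply: subspace_continuous_measurable_fun => //; exact: cdphiab.
have dphi_ge0 x : `[a, b]%classic x -> 0 <= dphi x.
  by rewrite /= in_itv/= => /dphi0/ltW.
have mab : measurable (`[a, b]%classic : set (measurableTypeR R)) by [].
have mJ : measurable (`[phi a, phi b]%classic : set (measurableTypeR R)) by [].
(* the mass of [y, b] by the fundamental theorem of calculus *)
have ftc y : a <= y <= b ->
    (\int[mu]_(x in `[y, b]) (dphi x)%:E = (phi b - phi y)%:E)%E.
  move=> /andP[ay]; rewrite le_eqVlt => /predU1P[->|yb].
    by rewrite set_itv1 integral_set1 subrr.
  rewrite (@continuous_FTC2 _ dphi phi y b)//; first exact: cdphiab.
  - split.
    + move=> x; rewrite in_itv/= => /andP[yx xb].
      have xab : a <= x <= b by lra.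
      by have [] := dphiP _ xab.
    + by apply: cvg_at_right_filter; apply: cphi; lra.
    + by apply: cvg_at_left_filter; apply: cphi; lra.
  - move=> x; rewrite in_itv/= => /andP[yx xb].
    have xab : a <= x <= b by lra.
    by rewrite derive1E; have [_ ->] := dphiP _ xab.
rewrite (@ge0_integral_weighted_image _ _ (measurableTypeR R) (measurableTypeR R)
  R mu _ phi dphi mab mphi mdphi dphi_ge0 (mrestr mu mJ) f)//.
  rewrite [RHS](_ : _ = (\int[mrestr mu mJ]_(y in `[phi a, phi b]) f y)%E).
    rewrite [RHS]integral_mkcond.
    apply: ae_eq_integral => //.
      by apply/(measurable_restrictT _ _).1 => //; exact: measurable_funS mf.
    exists (~` `[phi a, phi b]%classic); split => //.
    - exact: measurableC.
    - by rewrite /= /mrestr setICl measure0.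
    - move=> y /= h; apply: contra_not h => yJ _.
      by rewrite patchE ifT// inE.
  apply: eq_measure_integral => A mA AJ.
  by rewrite /= /mrestr setIidl.
apply: lebesgue_eq_on_rays.
  rewrite /= /weighted_image preimage_setT setIT ftc ?ltry//.
  by rewrite lexx ltW.
move=> c; rewrite /= /mrestr /weighted_image.
have [cb|bc] := leP c (phi b); last first.
  rewrite [X in integral _ X _](_ : _ = set0) ?integral_set0; last first.
    apply/seteqP; split => // x /=; rewrite !in_itv/= andbT => -[/andP[ax xb]].
    by rewrite leNgt (le_lt_trans _ bc)// phi_le.
  rewrite [X in lebesgue_measure X](_ : _ = set0) ?measure0//.
  apply/seteqP; split => // x /=; rewrite !in_itv/= andbT => -[cx /andP[ax xb]].
  by move: bc; rewrite ltNge (le_trans cx).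
have [ca|ac] := leP c (phi a).
  rewrite [X in integral _ X _](_ : _ = `[a, b]%classic); last first.
    apply/seteqP; split => [x []//|x /=]; rewrite !in_itv/= andbT => xab.
    by split => //; apply: (le_trans ca); apply: phi_le; lra.
  rewrite ftc; last by rewrite lexx ltW.
  rewrite [X in lebesgue_measure X](_ : _ = `[phi a, phi b]%classic); last first.
    apply/seteqP; split => [x []//|x /=]; rewrite !in_itv/= andbT => xab.
    by split => //; lra.
  by rewrite lebesgue_measure_itv/= lte_fin phi_lt//= in_itv/= lexx ltW.
have [y yab yc] : exists2 y, y \in `[a, b]%R & phi y = c.
  apply: IVT; [exact: ltW|exact: cphiab|].
  by rewrite ge_min le_max (ltW ac) cb orbT.
move: yab; rewrite in_itv/= => yab; move/andP: (yab) => [ay yb].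
rewrite [X in integral _ X _](_ : _ = `[y, b]%classic); last first.
  apply/seteqP; split => x /=; rewrite !in_itv/= andbT -yc.
    move=> [/andP[ax ->]]; rewrite andbT => yx; rewrite leNgt; apply/negP => xy.
    have := phi_lt x y; rewrite !in_itv/= ax ay yb (ltW (lt_le_trans xy yb)).
    by move=> /(_ isT isT xy); rewrite ltNge yx.
  by move=> /andP[yx xb]; split; [lra|exact: phi_le].
rewrite ftc//.
rewrite [X in lebesgue_measure X](_ : _ = `[c, phi b]%classic); last first.
  apply/seteqP; split => x /=; rewrite !in_itv/= andbT.
    by move=> [-> /andP[]].
  by move=> /andP[cx xb]; split => //; lra.
rewrite lebesgue_measure_itv/= lte_fin yc; case: ltP => // bc.
by congr (_%:E); lra.
Qed.

End change_of_variables.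

Section change_of_variables2.
Context {R : realType}.
Notation mu := (@lebesgue_measure R).
Implicit Types (D : set R) (phi dphi : R -> R) (f : R -> \bar R).

(** The domains to which a change of variables valid on compact segments extends
    by monotone convergence. *)
Definition segment_exhausted D := exists a b : nat -> R,
  [/\ forall n, a n < b n, nonincreasing_seq a, nondecreasing_seq b &
      D = \bigcup_n `[a n, b n]%classic].

Lemma segment_exhausted_setT : segment_exhausted setT.
Proof.
exists (fun n => - n.+1%:R), (fun n => n.+1%:R); split.
- by move=> n; rewrite gtrN.
- by move=> m n mn; rewrite lerN2 ler_nat.
- by move=> m n mn; rewrite ler_nat.
- apply/seteqP; split=> // x _; exists (Num.truncn `|x|) => //=.
  by rewrite in_itv/= -ler_norml ltW// truncnS_gt.
Qed.

Lemma segment_exhausted_itvoy (c : R) : segment_exhausted `]c, +oo[.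
Proof.
exists (fun n => c + n.+1%:R^-1), (fun n => c + n.+2%:R); split.
- move=> n; rewrite ltrD2l (@le_lt_trans _ _ 1) ?ltr1n//.
  by rewrite invf_le1 ?ler1n.
- by move=> m n mn; rewrite lerD2l lef_pV2 ?posrE// ler_nat.
- by move=> m n mn; rewrite lerD2l ler_nat.
- apply/seteqP; split=> x /=; rewrite in_itv/= andbT; last first.
    move=> [n _ /=]; rewrite in_itv/= => /andP[+ _]; apply: lt_le_trans.
    by rewrite ltrDl.
  move=> cx; have xc : 0 < x - c by rewrite subr_gt0.
  exists (Num.truncn (x - c)^-1 + Num.truncn (x - c))%N => //=.
  rewrite in_itv/= -lerBrDl; apply/andP; split.
    rewrite -[leRHS]invrK lef_pV2 ?posrE ?invr_gt0//.
    apply: le_trans (ltW (truncnS_gt _)) _.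
    by rewrite ler_nat ltnS leq_addr.
  rewrite -lerBlDl; apply: le_trans (ltW (truncnS_gt _)) _.
  by rewrite ler_nat ltnS -addSn leq_addl.
Qed.

Lemma segment_exhaustedN D : segment_exhausted D -> segment_exhausted (-%R @` D).
Proof.
move=> [a [b [ab ha hb ->]]]; exists (fun n => - b n), (fun n => - a n); split.
- by move=> n; rewrite ltrN2.
- by move=> m n /hb; rewrite lerN2.
- by move=> m n /ha; rewrite lerN2.
- rewrite image_bigcup; apply: eq_bigcup => // n _.
  apply/seteqP; split=> x /=; rewrite ?in_itv/=.
    by move=> [y /[!in_itv]/= /andP[ay yb] <-]; rewrite !lerN2 ay yb.
  by move=> /andP[bx xa]; exists (- x); rewrite ?opprK// in_itv/=; lra.
Qed.

Lemma segment_exhausted_itvNyo (c : R) : segment_exhausted `]-oo, c[.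
Proof.
have := segment_exhaustedN (segment_exhausted_itvoy (- c)).
congr segment_exhausted; apply/seteqP; split=> x /=; rewrite in_itv/=.
  by move=> [y /[!in_itv]/= /[!andbT] cy <-]; lra.
by move=> xc; exists (- x); rewrite ?opprK// in_itv/= ltrN2 xc.
Qed.

Lemma segment_exhausted_measurable D : segment_exhausted D -> measurable D.
Proof. by move=> [a [b [_ _ _ ->]]]; exact: bigcupT_measurable. Qed.

Section smooth_monotone.
Variables (D : set R) (phi dphi : R -> R) (s : R).
Hypotheses (exD : segment_exhausted D).
Hypothesis dphiP : forall x, D x -> is_derive x 1 phi (dphi x).
Hypothesis cdphi : forall x, D x -> {for x, continuous dphi}.

Let cphi x : D x -> {for x, continuous phi}.
Proof.
move=> Dx; apply/differentiable_continuous; rewrite -derivable1_diffP.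
by have [] := dphiP Dx.
Qed.

Lemma ge0_change_of_variables_increasing f :
  (forall x, D x -> 0 < dphi x) ->
  measurable_fun setT f -> (forall y, 0 <= f y)%E ->
  segment_exhausted (phi @` D) /\
  (\int[mu]_(x in D) (f (phi x) * (dphi x)%:E) =
   \int[mu]_(y in phi @` D) f y)%E.
Proof.
move=> dphi0 mf f0; case: exD => a [b [ab ha hb DE]].
have subD n x : a n <= x <= b n -> D x.
  by move=> xab; rewrite DE; exists n => //=; rewrite in_itv.
have phi_lt n : {in `[a n, b n]%R &, {homo phi : x y / x < y}}.
  apply: gtr0_derive1_lt_cc.
  - move=> x; rewrite in_itv/= => /andP[/ltW ax /ltW xb].
    by have [] := dphiP (subD n x _); rewrite ?ax ?xb.
  - move=> x; rewrite in_itv/= => /andP[/ltW ax /ltW xb].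
    have xab : a n <= x <= b n by rewrite ax xb.
    by rewrite derive1E; have [_ ->] := dphiP (subD _ _ xab); exact/dphi0/subD/xab.
  - apply: continuous_in_subspaceT => x.
    by rewrite inE/= in_itv/= => xab; apply/cphi/subD/xab.
have phi_le n x y : a n <= x -> x <= y -> y <= b n -> phi x <= phi y.
  move=> ax; rewrite le_eqVlt => /predU1P[->//|xy yb].
  by apply/ltW/(phi_lt n) => //; rewrite in_itv/=; lra.
have phiab n : phi @` `[a n, b n] = `[phi (a n), phi (b n)]%classic.
  apply/seteqP; split=> y /=; rewrite ?in_itv/=.
    by move=> [x /[!in_itv]/= /andP[ax xb] <-]; rewrite !(phi_le n).
  move=> /andP[ay yb]; apply: IVT; first exact/ltW.
    apply: continuous_in_subspaceT => x.
    by rewrite inE/= in_itv/= => xab; apply/cphi/subD/xab.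
  by rewrite ge_min le_max ay yb orbT.
have phiDE : phi @` D = \bigcup_n `[phi (a n), phi (b n)]%classic.
  by rewrite DE image_bigcup; apply: eq_bigcup.
split.
  exists (phi \o a), (phi \o b); split => //.
  - by move=> n; apply: (phi_lt n); rewrite ?in_itv/= ?lexx// ?ltW.
  - move=> m n mn; apply: (phi_le n) => //; first exact: ha.
    exact: le_trans (ltW (ab m)) (hb _ _ mn).
  - move=> m n mn; apply: (phi_le n) => //; last exact: hb.
    exact: le_trans (ha _ _ mn) (ltW (ab m)).
have nd (c d : nat -> R) : nonincreasing_seq c -> nondecreasing_seq d ->
    nondecreasing_seq (fun n => `[c n, d n]%classic).
  move=> hc hd m n mn; apply/subsetPset => x /=; rewrite !in_itv/=.
  by move=> /andP[cx xd]; rewrite (le_trans (hc _ _ mn))//= (le_trans xd)// hd.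
have mphi n : measurable_fun (`[a n, b n] : set R) phi.
  apply: subspace_continuous_measurable_fun => //.
  apply: continuous_in_subspaceT => x.
  by rewrite inE/= in_itv/= => xab; apply/cphi/subD/xab.
have mdphi n : measurable_fun (`[a n, b n] : set R) dphi.
  apply: subspace_continuous_measurable_fun => //.
  apply: continuous_in_subspaceT => x.
  by rewrite inE/= in_itv/= => xab; apply/cdphi/subD/xab.
have segE n : (\int[mu]_(x in `[a n, b n]) (f (phi x) * (dphi x)%:E) =
   \int[mu]_(y in `[phi (a n), phi (b n)]) f y)%E.
  apply: ge0_integral_segment_image => //.
  - by move=> x /subD/dphiP.
  - by move=> x /subD/cdphi.
  - by move=> x /subD/dphi0.
have mfphi n : measurable_fun (`[a n, b n] : set R)
    (fun x => f (phi x) * (dphi x)%:E)%E.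
  apply: emeasurable_funM; last exact/measurable_EFinP.
  exact: measurableT_comp.
have fphi0 n x : `[a n, b n]%classic x -> (0 <= f (phi x) * (dphi x)%:E)%E.
  rewrite /= in_itv/= => /subD Dx.
  by rewrite mule_ge0// lee_fin ltW// dphi0.
have := @ge0_nondecreasing_set_cvg_integral _ (measurableTypeR R) R _
  (fun x => f (phi x) * (dphi x)%:E)%E mu (nd a b ha hb)
  (fun n => measurable_itv _) mfphi fphi0.
rewrite -DE => /cvg_lim <-//.
rewrite (funext segE) phiDE; apply/cvg_lim => //.
apply: ge0_nondecreasing_set_cvg_integral => //.
- apply: nd => m n mn; last first.
    apply: (phi_le n) => //; last exact: hb.
    exact: le_trans (ha _ _ mn) (ltW (ab m)).
  apply: (phi_le n) => //; first exact: ha.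
  exact: le_trans (ltW (ab m)) (hb _ _ mn).
- by move=> n; exact: measurable_funS mf.
Qed.

End smooth_monotone.

Lemma ge0_integralN D f : measurable D -> measurable_fun setT f ->
  (forall y, 0 <= f y)%E ->
  (\int[mu]_(x in D) f (- x)%R = \int[mu]_(x in -%R @` D) f x)%E.
Proof.
move=> mD mf f0.
have mN : measurable_fun setT (-%R : measurableTypeR R -> measurableTypeR R).
  exact: measurable_funN.
have ND : -%R @` D = -%R @^-1` D.
  apply/seteqP; split=> x /=; first by move=> [y Dy <-]; rewrite opprK.
  by move=> Dx; exists (- x) => //; rewrite opprK.
have DE : D = (-%R : measurableTypeR R -> measurableTypeR R) @^-1` (-%R @^-1` D).
  by apply/seteqP; split=> x /=; rewrite opprK.
have mND : measurable (-%R @^-1` D : set R).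
  by rewrite -[X in measurable X]setTI; exact: mN.
rewrite ND [in LHS]DE -(ge0_integral_pushforward mN)//.
  apply: eq_measure_integral => A mA _; exact: lebesgue_measureN.
exact: measurable_funS mf.
Qed.

(** The decreasing case reduces to the increasing one by the reflection
    [y |-> - y]. *)
Lemma ge0_change_of_variables D phi dphi f (e : bool) :
  segment_exhausted D ->
  (forall x, D x -> is_derive x 1 phi (dphi x)) ->
  (forall x, D x -> {for x, continuous dphi}) ->
  (forall x, D x -> 0 < (-1) ^+ e * dphi x) ->
  measurable_fun setT f -> (forall y, 0 <= f y)%E ->
  measurable (phi @` D) /\
  (\int[mu]_(x in D) (f (phi x) * `|dphi x|%:E) =
   \int[mu]_(y in phi @` D) f y)%E.
Proof.
case: e => exD dphiP cdphi dphi0 mf f0; last first.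
  have {}dphi0 x : D x -> 0 < dphi x by move=> /dphi0; rewrite mul1r.
  have [ex <-] := ge0_change_of_variables_increasing exD dphiP cdphi dphi0 mf f0.
  split; first exact: segment_exhausted_measurable ex.
  by apply: eq_integral => x /[!inE] /dphi0 ?; rewrite gtr0_norm.
have {}dphi0 x : D x -> 0 < - dphi x by move=> /dphi0; rewrite mulN1r.
have mfN : measurable_fun setT (fun y : R => f (- y)).
  by apply: measurableT_comp => //; exact: measurable_funN.
have [ex E] := @ge0_change_of_variables_increasing D (fun x => - phi x)
  (fun x => - dphi x) exD (fun x Dx => is_deriveN (dphiP x Dx))
  (fun x Dx => continuousN (cdphi x Dx)) (fun y : R => f (- y)) dphi0 mfN (fun y => f0 _).
have imE : -%R @` ((fun x => - phi x) @` D) = phi @` D.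
  by rewrite image_comp; apply: eq_imagel => x _ /=; rewrite opprK.
split.
  by rewrite -imE; exact: segment_exhausted_measurable (segment_exhaustedN ex).
rewrite -imE -ge0_integralN//; last exact: segment_exhausted_measurable ex.
rewrite -E; apply: eq_integral => x /[!inE] /dphi0 ?.
by rewrite opprK ltr0_norm// -oppr_gt0.
Qed.

End change_of_variables2.

(** * Densities and the plane Lebesgue measure *)

Section densities.
Context {R : realType}.
Notation mu := (@lebesgue_measure R).
Implicit Types f g : R -> R.

Lemma measurable_invr : measurable_fun setT (fun x : R => x^-1).
Proof.
have -> : [set: R] = [set 0] `|` ~` [set 0] by rewrite setUv.
apply/measurable_funU => //; first exact: measurableC.
split; first exact: measurable_fun_set1.
apply: open_continuous_measurable_fun; first by apply: closed_openC; exact: closed_eq.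
by move=> x; rewrite inE/= => /eqP x0; exact: inv_continuous.
Qed.

Lemma tonelli_swap (k : R -> R -> \bar R) :
  measurable_fun setT (fun z : R * R => k z.1 z.2) ->
  (forall x y, 0 <= k x y)%E ->
  (\int[mu]_x \int[mu]_y k x y = \int[mu]_y \int[mu]_x k x y)%E.
Proof.
move=> mk k0.
exact: (@fubini_tonelli _ _ (measurableTypeR R) (measurableTypeR R) R mu mu
  (fun z => k z.1 z.2) mk (fun z => k0 z.1 z.2)).
Qed.

Lemma lebesgue2E (K : set (R * R)) : measurable K ->
  ((lebesgue_measure \x lebesgue_measure) K =
   \int[mu]_y \int[mu]_x (\1_K (x, y))%:E)%E.
Proof.
move=> mK.
pose f (z : measurableTypeR R * measurableTypeR R) : \bar R := (\1_K z)%:E.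
have mf : measurable_fun setT f.
  by apply/measurable_EFinP; exact: measurable_indic.
have f0 z : (0 <= f z)%E by rewrite lee_fin.
transitivity (\int[mu \x mu]_z f z)%E; first by rewrite integral_indic// setIT.
rewrite (fubini_tonelli1 f mf f0) /fubini_F.
exact: (@fubini_tonelli _ _ (measurableTypeR R) (measurableTypeR R) R mu mu f mf f0).
Qed.

Lemma measurable_preimageT d (X : measurableType d) (f : X -> R) (B : set R) :
  measurable_fun setT f -> measurable B -> measurable (f @^-1` B).
Proof. by move=> mf mB; rewrite -[X in measurable X]setTI; exact: mf. Qed.

(** Uniqueness of densities, by comparison on the bounded sets where [g <= n], on
    which [g] is integrable. *)
Lemma ae_eq_of_integrals f g :
  measurable_fun (`]0, +oo[ : set R) f -> measurable_fun (`]0, +oo[ : set R) g ->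
  (forall x, 0 < x -> 0 <= g x) ->
  (forall E : set R, measurable E -> E `<=` `]0, +oo[ ->
     (\int[mu]_(x in E) (f x)%:E = \int[mu]_(x in E) (g x)%:E)%E) ->
  {ae mu, forall x, 0 < x -> f x = g x}.
Proof.
move=> mf mg g0 fgE.
pose D n : set R := `]0, n%:R]%classic `&` (`]0, +oo[%classic `&` g @^-1` `]-oo, n%:R]).
have mD n : measurable (D n) by apply: measurableI => //; exact: mg.
have D0 n : D n `<=` `]0, +oo[ by move=> x [_ []].
have aen n : {ae mu, forall x, D n x -> f x = g x}.
  have ig : mu.-integrable (D n) (EFin \o g).
    apply: measurable_bounded_integrable => //.
    - exact: mD.
    - rewrite (@le_lt_trans _ _ (mu `]0, n%:R]%classic))//.
        apply: le_measure; rewrite ?inE; [exact: mD|exact: measurable_itv|].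
        exact: subIsetl.
      by rewrite lebesgue_measure_itv/=; case: ifP => // _; rewrite -EFinB ltry.
    - exact: measurable_funS mg.
    - exists n%:R; split => // M nM x [_ []]/=.
      rewrite !in_itv/= andbT => x0 gn.
      by rewrite ger0_norm ?g0// (le_trans gn)// ltW.
  have : ae_eq mu (D n) (EFin \o g) (EFin \o f).
    apply: integral_ae_eq => //; first exact: mD.
      by apply/measurable_EFinP; exact: measurable_funS mf.
    move=> E ED mE; rewrite -fgE//; exact: subset_trans (D0 n).
  by apply: filterS => x /= + Dx => /(_ Dx)[].
have := ae_foralln aen; apply: filterS => x /= fgx x0.
apply: (fgx (maxn (Num.truncn x).+1 (Num.truncn (g x)).+1)).
have h (y : R) m : (Num.truncn y < m)%N -> y <= m%:R.
  by move=> ym; apply: ltW; apply: lt_le_trans (truncnS_gt _) _; rewrite ler_nat.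
by split=> /=; rewrite ?in_itv/= ?x0/= ?h// leq_max leqnn// orbT.
Qed.

(** If the values differed at [l], they would differ on a ball, which has positive
    measure. *)
Lemma eq_at_continuity_point f g (l : R) : 0 < l ->
  {for l, continuous f} -> {for l, continuous g} ->
  {ae mu, forall x, 0 < x -> f x = g x} -> f l = g l.
Proof.
move=> l0 cf cg [N [mN N0 fgN]]; apply: contrapT => /eqP fgl.
have : \forall x \near l, 0 < x /\ f x != g x.
  near=> x; split; first by near: x; exact: lt_nbhsr.
  rewrite -subr_eq0; near: x.
  have : (fun x => f x - g x) @ l --> f l - g l by exact: cvgB.
  by move=> /cvgr_neq0; apply; rewrite subr_eq0.
move=> /nbhs_ballP[e /= e0 eN].
have : (mu (ball l e) <= mu N)%E.
  apply: le_measure; rewrite ?inE//; first exact: measurable_ball.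
  move=> x /eN [x0 /eqP fgx]; apply: fgN => /= /(_ x0).
  exact: fgx.
rewrite N0 lebesgue_measure_ball; last exact: ltW.
by rewrite lee_fin leNgt mulrn_wgt0.
Unshelve. all: by end_near. Qed.

End densities.

(** * Coordinates of lines *)

Section line_coordinates.
Context {R : realType}.
Notation mu := (@lebesgue_measure R).
Implicit Types (M u v w : R * R) (t : R).

(** The coordinate [p] of the line through [M] with direction angle [t]. It is
    linear in [M], so it also measures how far a vector is from this direction. *)
Definition offset M t : R := M.2 * cos t - M.1 * sin t.

Lemma lineE l M : line l M <-> offset M l.2 = l.1.
Proof. by []. Qed.

Lemma offsetD M v a t : offset (M + a *: v) t = offset M t + a * offset v t.
Proof. by rewrite /offset/= /GRing.scale/=; ring. Qed.

Lemma offsetB M v t : offset (M - v) t = offset M t - offset v t.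
Proof. by rewrite /offset/=; ring. Qed.

Lemma cross_eq0_of_offset v w t :
  offset v t = 0 -> offset w t = 0 -> cross v w = 0.
Proof.
rewrite /offset /cross => v0 w0; have := cos2Dsin2 t => cs.
have E c : c = c * (cos t ^+ 2 + sin t ^+ 2) by rewrite cs mulr1.
rewrite (E (v.1 * _ - _)); apply/eqP; rewrite -subr_eq0; apply/eqP.
have -> : (v.1 * w.2 - v.2 * w.1) * (cos t ^+ 2 + sin t ^+ 2) - 0 =
  (v.1 * cos t + v.2 * sin t) * (w.2 * cos t - w.1 * sin t)
  - (w.1 * cos t + w.2 * sin t) * (v.2 * cos t - v.1 * sin t) by ring.
by rewrite v0 w0 !mulr0 subrr.
Qed.

Lemma measurable_cosr : measurable_fun setT (@cos R).
Proof. by apply: continuous_measurable_fun; exact: continuous_cos. Qed.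

Lemma measurable_sinr : measurable_fun setT (@sin R).
Proof. by apply: continuous_measurable_fun; exact: continuous_sin. Qed.

Lemma measurable_offset d (X : measurableType d) (D : set X) M (f : X -> R) :
  measurable_fun D f -> measurable_fun D (fun x => offset M (f x)).
Proof.
move=> mf; apply: measurable_funB; apply: measurable_funM => //.
  by apply: measurableT_comp => //; exact: measurable_cosr.
by apply: measurableT_comp => //; exact: measurable_sinr.
Qed.

Lemma measurable_divr d (X : measurableType d) (D : set X) (f g : X -> R) :
  measurable_fun D f -> measurable_fun D g ->
  measurable_fun D (fun x => f x / g x).
Proof.
move=> mf mg; apply: measurable_funM => //.
by apply: measurableT_comp => //; exact: measurable_invr.
Qed.

Lemma measurable_sqrtr d (X : measurableType d) (D : set X) (f : X -> R) :
  measurable_fun D f -> measurable_fun D (fun x => Num.sqrt (f x)).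
Proof.
have ms : measurable_fun setT (fun x : R => Num.sqrt x).
  by apply: continuous_measurable_fun; exact: sqrt_continuous.
exact: measurableT_comp.
Qed.

Lemma measurable_eucl_dist d (X : measurableType d) (D : set X) A u C w
    (f g : X -> R) : measurable_fun D f -> measurable_fun D g ->
  measurable_fun D (fun x => eucl_dist (A + f x *: u) (C + g x *: w)).
Proof.
move=> mf mg; rewrite /eucl_dist; apply: measurable_sqrtr.
apply: measurable_funD; apply: measurable_funX; apply: measurable_funB => /=;
  by apply: measurable_funD => //; apply: measurable_funM.
Qed.

Lemma measurable_cross d (X : measurableType d) (D : set X) A u C w x
    (f g : X -> R) : measurable_fun D f -> measurable_fun D g ->
  measurable_fun D (fun z => cross ((C + g z *: w) - (A + f z *: u)) x).
Proof.
move=> mf mg; rewrite /cross; apply: measurable_funB; apply: measurable_funM => //=;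
  apply: measurable_funB; apply: measurable_funD => //; apply: measurable_funM => //.
Qed.

End line_coordinates.

Section angle.
Context {R : realType}.
Notation mu := (@lebesgue_measure R).

(** The direction angle of [v] in the open interval from [0] to [pi], when [v] is
    not horizontal: the arc cotangent of its slope coordinate [v.1 / v.2]. *)
Definition angle (v : R * R) : R := pi / 2 - atan (v.1 / v.2).

Lemma angle_itv (v : R * R) : 0 < angle v < pi.
Proof.
rewrite /angle; have := atan_gtNpi2 (v.1 / v.2); have := atan_ltpi2 (v.1 / v.2).
by move=> h1 h2; lra.
Qed.

(** The sign of [c] is that of [v.2]: a direction angle is defined modulo [pi]. *)
Lemma angle_polar (v : R * R) : v.2 != 0 -> exists2 c : R,
  `|c| = (Num.sqrt (v.1 ^+ 2 + v.2 ^+ 2))^-1 &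
  cos (angle v) = c * v.1 /\ sin (angle v) = c * v.2.
Proof.
move=> v20; rewrite /angle; set y := atan _.
have sq : 1 + (v.1 / v.2) ^+ 2 = (v.1 ^+ 2 + v.2 ^+ 2) / v.2 ^+ 2 by field.
have s0 : 0 < v.1 ^+ 2 + v.2 ^+ 2.
  by rewrite ltr_wpDl ?sqr_ge0// exprn_even_gt0.
have cy : cos y = `|v.2| / Num.sqrt (v.1 ^+ 2 + v.2 ^+ 2).
  rewrite cos_atan sq sqrtrM ?ltW// sqrtrV ?sqr_ge0// sqrtr_sqr.
  by rewrite invfM invrK mulrC.
exists (cos y / v.2).
  rewrite cy normrM normfV normrM normr_id ger0_norm ?invr_ge0 ?sqrtr_ge0//.
  by rewrite mulrAC mulfV ?mul1r// normr_eq0.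
have cy0 : cos y != 0 by rewrite cy mulf_neq0 ?normr_eq0// invr_eq0 sqrtr_eq0 -ltNge.
have ty : tan y = v.1 / v.2 by rewrite atanK.
have sy : sin y = cos y / v.2 * v.1.
  by rewrite mulrAC -mulrA -ty /tan mulrC -mulrA mulVf// mulr1.
rewrite sinB cosB cos_pihalf sin_pihalf; split; rewrite -?sy; first by ring.
by rewrite divfK//; ring.
Qed.

Lemma angle_unique (v : R * R) (t c : R) : 0 < t < pi -> c != 0 ->
  v.1 = c * cos t -> v.2 = c * sin t -> angle v = t.
Proof.
move=> tpi c0 v1 v2; rewrite /angle v1 v2 -mulf_div divff// mul1r.
have -> : cos t / sin t = tan (pi / 2 - t).
  by rewrite /tan sinB cosB cos_pihalf sin_pihalf; congr (_ / _); ring.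
by rewrite tanK ?in_itv/=; lra.
Qed.

End angle.

(** * The measure of the lines joining two sets of points *)

Section lines_by_endpoints.
Context {R : realType}.
Notation mu := (@lebesgue_measure R).
Variables (A u C w : R * R) (T : set (R * R)) (E : set R).

Definition chord_vec (s r : R) : R * R := (C + r *: w) - (A + s *: u).

Definition chord_length (s r : R) : R := eucl_dist (A + s *: u) (C + r *: w).

Definition chord_weight (s r : R) : R :=
  `|cross (chord_vec s r) u| * `|cross (chord_vec s r) w| / chord_length s r ^+ 3.

Definition lines_joining : set (R * R) :=
  [set l | exists s r : R, [/\ T (s, r), line l (A + s *: u),
     line l (C + r *: w) & E (chord_length s r)]].

Hypotheses (mT : measurable T) (mE : measurable E).
Hypothesis transversal : forall s r, T (s, r) ->
  cross (chord_vec s r) u != 0 /\ cross (chord_vec s r) w != 0.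

Let K := lines_joining `&` [set l | 0 <= l.2 < pi].

(** A line transversal to both supporting lines determines the endpoints of its
   chord. *)
Let joinP l s r : T (s, r) -> line l (A + s *: u) -> line l (C + r *: w) ->
  [/\ offset u l.2 != 0, offset w l.2 != 0,
      s = (l.1 - offset A l.2) / offset u l.2 &
      r = (l.1 - offset C l.2) / offset w l.2].
Proof.
move=> /transversal[cu cw] /lineE lA /lineE lC.
have v0 : offset (chord_vec s r) l.2 = 0.
  by rewrite /chord_vec offsetB lC lA subrr.
have u0 : offset u l.2 != 0.
  by apply: contra_neq cu; exact: cross_eq0_of_offset.
have w0 : offset w l.2 != 0.
  by apply: contra_neq cw; exact: cross_eq0_of_offset.
split=> //.
  by rewrite -lA offsetD addrAC subrr add0r mulfK.
by rewrite -lC offsetD addrAC subrr add0r mulfK.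
Qed.

Let mK : measurable K.
Proof.
pose S (l : R * R) := (l.1 - offset A l.2) / offset u l.2.
pose Q (l : R * R) := (l.1 - offset C l.2) / offset w l.2.
have m1 : measurable_fun setT (fun l : R * R => l.1) by exact: measurable_fst.
have m2 : measurable_fun setT (fun l : R * R => l.2) by exact: measurable_snd.
have mS : measurable_fun setT S.
  apply: measurable_divr; last exact: measurable_offset.
  by apply: measurable_funB => //; exact: measurable_offset.
have mQ : measurable_fun setT Q.
  apply: measurable_divr; last exact: measurable_offset.
  by apply: measurable_funB => //; exact: measurable_offset.
rewrite (_ : K = (snd @^-1` `[0, pi[) `&` ((fun l => offset u l.2) @^-1` ~` [set 0])
  `&` ((fun l => offset w l.2) @^-1` ~` [set 0])
  `&` ((fun l => (S l, Q l)) @^-1` T) `&` ((fun l => chord_length (S l) (Q l)) @^-1` E)).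
  apply: measurableI; last by apply: measurable_preimageT => //; exact: measurable_eucl_dist.
  apply: measurableI; last first.
    rewrite -[X in measurable X]setTI.
    by have := measurable_fun_pair mS mQ; apply.
  apply: measurableI; last first.
    by apply: measurable_preimageT; [exact: measurable_offset|exact: measurableC].
  apply: measurableI; last first.
    by apply: measurable_preimageT; [exact: measurable_offset|exact: measurableC].
  exact: measurable_preimageT.
apply/seteqP; split=> [l [[s [r [Tsr lA lC Esr]]] /= lpi]|l].
  have [u0 w0 sE rE] := joinP Tsr lA lC.
  rewrite /S /Q -sE -rE; split=> //; split=> //; split; last by move/eqP: w0.
  by split; [rewrite /= in_itv|move/eqP: u0].
move=> [[[[/= lpi /eqP u0] /eqP w0] TSQ] ESQ]; split.
  exists (S l), (Q l); split => //; apply/lineE; rewrite offsetD /S /Q divfK//.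
    by rewrite addrC subrK.
  by rewrite addrC subrK.
by move: lpi; rewrite in_itv.
Qed.

(** The indicator of [K] in the coordinates [(s, t)], where the line with angle [t]
   passes through the point at abscissa [s], times the Jacobian [dp = |offset u t| ds]. *)
Let k (s t : R) : \bar R :=
  ((\1_K (offset (A + s *: u) t, t))%:E * (`|offset u t|)%:E)%E.

Let mk : measurable_fun setT (fun z : R * R => k z.1 z.2).
Proof.
have m1 : measurable_fun setT (fun l : R * R => l.1) by exact: measurable_fst.
have m2 : measurable_fun setT (fun l : R * R => l.2) by exact: measurable_snd.
apply: emeasurable_funM; apply/measurable_EFinP; last first.
  by apply: measurableT_comp => //; exact: measurable_offset.
apply: (measurableT_comp (f := \1_K : R * R -> R)).
  exact: measurable_indic.
apply: measurable_fun_pair => //.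
under eq_fun do rewrite offsetD.
apply: measurable_funD; first exact: measurable_offset.
by apply: measurable_funM => //; exact: measurable_offset.
Qed.

Let k0 s t : (0 <= k s t)%E.
Proof. by rewrite /k mule_ge0// lee_fin. Qed.

(** For a fixed angle, [p] is an affine function of [s]. When [offset u t = 0] the
   line is parallel to the first segment and joins nothing. *)
Let line_measure_iterated :
  (line_measure lines_joining = \int[mu]_s \int[mu]_t k s t)%E.
Proof.
rewrite /line_measure (lebesgue2E mK).
rewrite [RHS](tonelli_swap mk k0).
apply: eq_integral => t _.
have [ut0|ut0] := eqVneq (offset u t) 0.
  transitivity (0 : \bar R)%E.
    apply: integral0_eq => p _; rewrite indicE memNset// => -[[s [r [Tsr lA lC _]]] _].
    by have [] := joinP Tsr lA lC; rewrite ut0 eqxx.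
  by apply/esym/integral0_eq => s _; rewrite /k/= ut0 normr0 mule0.
have mft : measurable_fun setT (fun p : R => (\1_K (p, t))%:E : \bar R).
  apply/measurable_EFinP; apply: (measurableT_comp (f := \1_K : R * R -> R)).
    exact: measurable_indic.
  exact: measurable_pair2.
have kK0 (p : R) : (0 <= (\1_K (p, t))%:E :> \bar R)%E by rewrite lee_fin.
pose phi (s : R) := offset A t + s * offset u t.
have dphi (s : R) : setT s -> is_derive s 1 phi (offset u t).
  by move=> _; apply: is_derive_eq; rewrite /GRing.scale/=; ring.
have cdphi (s : R) : setT s -> {for s, continuous (fun=> offset u t)}.
  by move=> _; exact: cst_continuous.
have dphi0 (s : R) : setT s -> 0 < (-1) ^+ (offset u t < 0)%R * offset u t.
  by move=> _; move: ut0; case: (ltgtP (offset u t) 0) => // h _;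
    rewrite ?expr1 ?expr0 ?mulN1r ?mul1r ?oppr_gt0.
have [_ ] := ge0_change_of_variables segment_exhausted_setT dphi cdphi dphi0 mft
  (fun p => kK0 p).
have -> : phi @` setT = setT.
  apply/seteqP; split=> // p _; exists ((p - offset A t) / offset u t) => //.
  by rewrite /phi divfK// addrC subrK.
move=> <-; apply: eq_integral => s _.
by rewrite /k/= offsetD.
Qed.

Let sqnorm (s r : R) : R := (chord_vec s r).1 ^+ 2 + (chord_vec s r).2 ^+ 2.

Let cross_dirE s r : cross (chord_vec s r) w = cross (chord_vec s 0) w.
Proof. by rewrite /cross /chord_vec/= /GRing.scale/=; ring. Qed.

Let sqnorm_gt0 s r : cross (chord_vec s 0) w != 0 -> 0 < sqnorm s r.
Proof.
rewrite -(cross_dirE s r) /cross /sqnorm => c0.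
rewrite lt_neqAle addr_ge0 ?sqr_ge0// andbT eq_sym.
rewrite paddr_eq0 ?sqr_ge0// !sqrf_eq0; apply: contra c0 => /andP[/eqP -> /eqP ->].
by rewrite !mul0r subrr.
Qed.

Let is_derive_angle s r : cross (chord_vec s 0) w != 0 ->
  (chord_vec s r).2 != 0 ->
  is_derive r 1 (fun r => angle (chord_vec s r))
    (cross (chord_vec s 0) w / sqnorm s r).
Proof.
move=> chi0 v20; rewrite /angle.
have d1 : is_derive r 1 (fun r : R => (chord_vec s r).1) w.1.
  by rewrite /chord_vec/= /GRing.scale/=; apply: is_derive_eq; rewrite /GRing.scale/=; ring.
have d2 : is_derive r 1 (fun r : R => (chord_vec s r).2) w.2.
  by rewrite /chord_vec/= /GRing.scale/=; apply: is_derive_eq; rewrite /GRing.scale/=; ring.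
have d3 := is_deriveM d1 (@is_deriveV R (fun r => (chord_vec s r).2) r _ 1 v20 d2).
have d4 := is_derive1_comp (is_derive1_atan _) d3.
have d5 := is_deriveB (is_derive_cst (pi / 2) r 1) d4.
apply: (is_derive_eq d5).
have n0 := sqnorm_gt0 r chi0.
rewrite -(cross_dirE s r) /GRing.scale/= !fctE.
pose a := C.1 + r * w.1 - (A.1 + s * u.1).
pose b := C.2 + r * w.2 - (A.2 + s * u.2).
have -> : cross (chord_vec s r) w = a * w.2 - b * w.1 by [].
have sqE : sqnorm s r = a ^+ 2 + b ^+ 2 by [].
rewrite sqE in n0 *; have {}n0 : a ^+ 2 + b ^+ 2 != 0 by rewrite gt_eqF.
have b0 : b != 0 := v20.
rewrite -/a -/b; clearbody a b.
by field; rewrite n0 b0.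
Qed.

(** For a fixed [s], the angle [t] is replaced by the abscissa [r] of the second
   endpoint. *)
Let slice s : (\int[mu]_t k s t =
  \int[mu]_r (\1_T (s, r) * \1_E (chord_length s r) * chord_weight s r)%:E)%E.
Proof.
have [chi0|chi0] := eqVneq (cross (chord_vec s 0) w) 0.
  rewrite !integral0_eq// => [r _|t _].
    by rewrite /chord_weight cross_dirE chi0 normr0 mulr0 mul0r mulr0.
  have [u0|u0] := eqVneq (offset u t) 0; first by rewrite /k u0 normr0 mule0.
  rewrite /k indicE memNset ?mul0e// => -[[s' [r' [T' lA lC _]]] _].
  have [_ _ s'E _] := joinP T' lA lC.
  have ss' : s' = s by rewrite s'E/= offsetD addrAC subrr add0r mulfK.
  by have [_] := transversal T'; rewrite ss' cross_dirE chi0 eqxx.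
pose F r := (\1_T (s, r) * \1_E (chord_length s r) * chord_weight s r : R).
rewrite -/F.
have F0 r : 0 <= F r.
  by rewrite /F !mulr_ge0// invr_ge0 exprn_ge0// sqrtr_ge0.
have mF : measurable_fun setT (EFin \o F).
  apply/measurable_EFinP; apply: measurable_funM.
    apply: measurable_funM.
      apply: (measurableT_comp (f := \1_T : R * R -> R)).
        exact: measurable_indic.
      exact: measurable_pair1.
    apply: (measurableT_comp (f := \1_E : R -> R)); first exact: measurable_indic.
    exact: measurable_eucl_dist.
  apply: measurable_divr; last by apply: measurable_funX; exact: measurable_eucl_dist.
  by apply: measurable_funM; apply: measurableT_comp => //; exact: measurable_cross.
have mks : measurable_fun setT (k s).
  exact: (measurableT_comp mk (measurable_pair1 s)).
(* The chord is horizontal at [r = rs], where the angle jumps from one end of its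
   range to the other. If the second line is horizontal there is no such point; the
   value of [rs] is then arbitrary, and the argument only loses a null set. *)
pose rs := - (chord_vec s 0).2 / w.2.
have v20 r : r != rs -> (chord_vec s r).2 != 0.
  have -> : (chord_vec s r).2 = (chord_vec s 0).2 + r * w.2.
    by rewrite /chord_vec/= /GRing.scale/=; ring.
  have [w20|w20] := eqVneq w.2 0.
    move=> _; rewrite w20 mulr0 addr0; apply: contra chi0 => /eqP v0.
    by rewrite /cross w20 v0 mulr0 mul0r subrr.
  apply: contra => /eqP h; apply/eqP; rewrite /rs; apply: (mulIf w20).
  by rewrite divfK//; move/eqP: h; rewrite addrC addr_eq0 => /eqP.
pose phi r := angle (chord_vec s r).
pose dphi r := cross (chord_vec s 0) w / sqnorm s r.
have phi_offset r : r != rs -> exists2 c : R, `|c| = (chord_length s r)^-1 &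
    forall x, offset x (phi r) = c * cross (chord_vec s r) x.
  move=> /v20/angle_polar[c cE [cc cs]]; exists c => // x.
  by rewrite /offset /phi cc cs /cross; ring.
have length_gt0 r : 0 < chord_length s r by rewrite sqrtr_gt0; exact: sqnorm_gt0.
(* The line of angle [phi r] through the first endpoint hits the second line at
   abscissa [r], which recovers [r] from [phi r]. *)
have phi_line r : r != rs -> offset (C + r *: w) (phi r) = offset (A + s *: u) (phi r)
    /\ offset w (phi r) != 0.
  move=> /[dup] rrs /phi_offset[c cE oE]; split.
    apply/eqP; rewrite -subr_eq0 -offsetB oE /cross mulrC; apply/eqP.
    by rewrite mulrC [X in c * (X - _)]mulrC subrr mulr0.
  rewrite oE cross_dirE mulf_neq0// -normr_eq0 cE invr_eq0 gt_eqF//.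
have phi_inj r r' : r != rs -> r' != rs -> phi r = phi r' -> r = r'.
  move=> /phi_line[pr _] /phi_line[+ w0] rr'; rewrite -rr' -pr => /eqP.
  rewrite !offsetD (inj_eq (addrI _)) => /eqP/mulIf -> //.
  by rewrite rr'.
have kphi r : r != rs -> (k s (phi r) * `|dphi r|%:E = (F r)%:E)%E.
  move=> rrs; have [pr w0] := phi_line _ rrs.
  have [c cE oE] := phi_offset _ rrs.
  have -> : k s (phi r) = (\1_T (s, r) * \1_E (chord_length s r) *
      (`|cross (chord_vec s r) u| / chord_length s r))%:E.
    have uE : `|offset u (phi r)| =
        `|cross (chord_vec s r) u| / chord_length s r.
      by rewrite oE normrM cE mulrC.
    rewrite /k -EFinM uE; congr (_ * _)%:E.
    rewrite !indicE -natrM mulnb; congr ((nat_of_bool _)%:R).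
    apply/idP/andP.
      move=> /set_mem[[s' [r' [T' lA lC E']]] _].
      have [u0 _ s'E r'E] := joinP T' lA lC.
      have ss' : s' = s by rewrite s'E/= offsetD addrAC subrr add0r mulfK.
      have rr' : r' = r by rewrite r'E/= -pr offsetD addrAC subrr add0r mulfK.
      by rewrite -ss' -rr'; split; apply/mem_set.
    move=> [/set_mem Tsr /set_mem Esr]; apply/mem_set; split.
      by exists s, r; split => //; rewrite lineE.
    by have /andP[/ltW p0 ppi] := angle_itv (chord_vec s r); rewrite /= p0 ppi.
  rewrite -EFinM /F; congr (_ %:E); rewrite -[LHS]mulrA; congr (_ * _).
  rewrite /chord_weight cross_dirE /dphi normrM normfV (gtr0_norm (sqnorm_gt0 _ chi0)).
  have -> : sqnorm s r = chord_length s r ^+ 2 by rewrite sqr_sqrtr// ltW// sqnorm_gt0.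
  by have := length_gt0 r; move: (chord_length s r) => L L0; field; rewrite gt_eqF.
pose D1 : set R := `]-oo, rs[%classic; pose D2 : set R := `]rs, +oo[%classic.
have D1n r : D1 r -> r != rs by rewrite /D1/= in_itv/= => ?; rewrite lt_eqF.
have D2n r : D2 r -> r != rs by rewrite /D2/= in_itv/= andbT => ?; rewrite gt_eqF.
have dphiP r : r != rs -> is_derive r 1 phi (dphi r).
  by move=> /v20; exact: is_derive_angle.
have cdphi r : {for r, continuous dphi}.
  apply: cvgM; first exact: cvg_cst.
  apply: cvgV; first by rewrite gt_eqF// sqnorm_gt0.
  rewrite /sqnorm /chord_vec/= /GRing.scale/=.
  by apply: cvgD; rewrite !expr2; apply: cvgM; apply: cvgB; (try exact: cvg_cst);
    apply: cvgD; (try exact: cvg_cst); apply: cvgM; (try exact: cvg_cst).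
have dphi0 r : 0 < (-1) ^+ (cross (chord_vec s 0) w < 0)%R * dphi r.
  rewrite /dphi mulrA; apply: divr_gt0; last exact: sqnorm_gt0.
  by move: chi0; case: (ltgtP (cross (chord_vec s 0) w) 0) => // h _;
    rewrite ?expr1 ?expr0 ?mulN1r ?mul1r ?oppr_gt0.
have [mI1 E1] := ge0_change_of_variables (segment_exhausted_itvNyo rs)
  (fun r (Dr : D1 r) => dphiP r (D1n r Dr)) (fun r _ => cdphi r)
  (fun r _ => dphi0 r) mks (k0 s).
have [mI2 E2] := ge0_change_of_variables (segment_exhausted_itvoy rs)
  (fun r (Dr : D2 r) => dphiP r (D2n r Dr)) (fun r _ => cdphi r)
  (fun r _ => dphi0 r) mks (k0 s).
have dI : [disjoint phi @` D1 & phi @` D2].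
  apply/disj_setPS => t [[r D1r <-] [r' D2r' /esym rr']].
  have := phi_inj r r' (D1n _ D1r) (D2n _ D2r') rr'.
  move: D1r D2r'; rewrite /D1 /D2/= !in_itv/= andbT => rlt ltr rr.
  by move: (lt_trans rlt ltr); rewrite rr ltxx.
transitivity (\int[mu]_(t in phi @` D1 `|` phi @` D2) k s t)%E.
  rewrite [RHS]integral_mkcond; apply: ge0_ae_eq_integral => //.
  - apply/(measurable_restrictT _ _).1; [exact: measurableU|exact: measurable_funS mks].
  - by move=> t _; rewrite patchE; case: ifP.
  exists [set 0; phi rs]; split.
  - exact: measurableU.
  - by apply: countable_lebesgue_measure0; exact: finite_set_countable.
  move=> t /= h; apply: contrapT => tN; apply: h => _.
  rewrite patchE; case: ifPn => // tI; rewrite /k indicE memNset ?mul0e//.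
  move=> [[s' [r [Tr lA lC _]]] /= t0pi].
  have [u0 _ s'E _] := joinP Tr lA lC.
  have ss' : s' = s by rewrite s'E/= offsetD addrAC subrr add0r mulfK.
  have ov : offset (chord_vec s r) t = 0.
    by rewrite /chord_vec offsetB; apply/eqP; rewrite subr_eq0; apply/eqP; exact: lC.
  (* [c] is the signed length of the chord vector along its direction. *)
  have tr : t = phi r.
    pose c := (chord_vec s r).1 * cos t + (chord_vec s r).2 * sin t.
    have := cos2Dsin2 t => cs.
    have e1 : (chord_vec s r).1 = c * cos t.
      rewrite /c -[LHS]mulr1 -cs; move: ov; rewrite /offset => ov.
      apply/eqP; rewrite -subr_eq0; apply/eqP.
      transitivity (- sin t * ((chord_vec s r).2 * cos t - (chord_vec s r).1 * sin t)).
        by ring.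
      by rewrite ov mulr0.
    have e2 : (chord_vec s r).2 = c * sin t.
      rewrite /c -[LHS]mulr1 -cs; move: ov; rewrite /offset => ov.
      apply/eqP; rewrite -subr_eq0; apply/eqP.
      transitivity (cos t * ((chord_vec s r).2 * cos t - (chord_vec s r).1 * sin t)).
        by ring.
      by rewrite ov mulr0.
    apply/esym; apply: (angle_unique (c := c)) => //.
      move: t0pi => /andP[t0 ->]; rewrite andbT lt_neqAle t0 andbT eq_sym.
      by apply/eqP => t00; apply: tN; left.
    apply/eqP => c0; move: chi0; rewrite -(cross_dirE s r) /cross e1 e2 c0.
    by rewrite !mul0r subrr eqxx.
  have [rrs|rrs|rrs] := ltgtP r rs.
  - by move: tI; rewrite notin_setE; apply; left; exists r; rewrite ?tr// /D1/= in_itv.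
  - by move: tI; rewrite notin_setE; apply; right; exists r;
      rewrite ?tr// /D2/= in_itv/= andbT.
  - by apply: tN; right; rewrite tr rrs.
rewrite ge0_integral_setU//; last exact: measurable_funS mks.
rewrite -E1 -E2.
have mD1 : measurable D1 by exact: measurable_itv.
have mD2 : measurable D2 by exact: measurable_itv.
have -> : (\int[mu]_(x in D1) (k s (phi x) * `|dphi x|%:E) =
    \int[mu]_(x in D1) (EFin \o F) x)%E.
  by apply: eq_integral => r /[!inE] /D1n/kphi.
have -> : (\int[mu]_(x in D2) (k s (phi x) * `|dphi x|%:E) =
    \int[mu]_(x in D2) (EFin \o F) x)%E.
  by apply: eq_integral => r /[!inE] /D2n/kphi.
rewrite -ge0_integral_setU//; first last.
- apply/disj_setPS => r []; rewrite /D1 /D2/= !in_itv/= andbT => rlt.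
  by move=> /(lt_trans rlt); rewrite ltxx.
- by move=> r _; rewrite lee_fin.
- exact: measurable_funS mF.
have -> : D1 `|` D2 = setT `\ rs.
  apply/seteqP; split=> r /=.
    by move=> [/D1n|/D2n] /eqP.
  by move=> [_ /eqP]; rewrite /D1 /D2/= !in_itv/= andbT neq_lt => /orP[]; [left|right].
rewrite integral_setD1//; first exact: measurableD.
exact: measurable_funS mF.
Qed.

(** In the coordinates given by its endpoints on two lines, the measure
    of lines is [sin alpha * sin beta / length ds dr], where [alpha] and [beta]
    are the angles of the chord with these lines. *)
Theorem line_measure_joining :
  (line_measure lines_joining = \int[mu]_s \int[mu]_r
    (\1_T (s, r) * \1_E (chord_length s r) * chord_weight s r)%:E)%E.
Proof. by rewrite line_measure_iterated; apply: eq_integral => s _; exact: slice. Qed.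

End lines_by_endpoints.

(** * The density of chord lengths *)

Section kernel.
Context {R : realType}.
Notation mu := (@lebesgue_measure R).

Lemma sqrt_sub_sqr_gt0 (h l : R) : `|h| < l -> 0 < Num.sqrt (l ^+ 2 - h ^+ 2).
Proof.
move=> hl; rewrite sqrtr_gt0 subr_gt0 -[ltLHS]real_normK ?num_real//.
by rewrite ltr_pXn2r ?nnegrE// (le_trans _ (ltW hl)).
Qed.

(** The substitution [r = r0 +- sqrt (l^2 - h^2)], whose two branches cover the
    line up to the point [r0]. *)
Lemma ge0_integral_hyperbola (h r0 : R) (G : R -> \bar R) : 0 < h ->
  measurable_fun setT G -> (forall r, 0 <= G r)%E ->
  (\int[mu]_r G r = \int[mu]_(l in `]h, +oo[)
     ((G (r0 + Num.sqrt (l ^+ 2 - h ^+ 2))%R + G (r0 - Num.sqrt (l ^+ 2 - h ^+ 2))%R)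
       * (l / Num.sqrt (l ^+ 2 - h ^+ 2))%:E))%E.
Proof.
move=> h0 mG G0.
pose D : set R := `]h, +oo[%classic; rewrite -/D.
pose q (l : R) := Num.sqrt (l ^+ 2 - h ^+ 2).
have Dh l : D l -> 0 < l ^+ 2 - h ^+ 2.
  rewrite /D/= in_itv/= andbT => hl; rewrite subr_gt0 ltr_pXn2r// nnegrE ltW//.
  exact: lt_trans hl.
have D0 l : D l -> 0 < l.
  by rewrite /D/= in_itv/= andbT => hl; exact: lt_trans hl.
have q0 l : D l -> 0 < q l by move=> /Dh; rewrite sqrtr_gt0.
have dq l : D l -> is_derive l 1 q (l / q l).
  move=> Dl.
  have d1 : is_derive l 1 (fun l : R => l ^+ 2 - h ^+ 2) (2 * l).
    by apply: is_derive_eq; rewrite /GRing.scale/=; ring.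
  have d2 := @is_derive1_comp _ Num.sqrt (fun l : R => l ^+ 2 - h ^+ 2) l _ _
    (is_derive1_sqrt (Dh _ Dl)) d1.
  apply: (is_derive_eq d2).
  by have := q0 _ Dl; rewrite /q; move: (Num.sqrt _) => y y0; field; rewrite gt_eqF.
have cq l : D l -> {for l, continuous (fun l : R => l / q l)}.
  move=> Dl; apply: cvgM; first exact: cvg_id.
  apply: cvgV; first by rewrite gt_eqF// q0.
  apply/differentiable_continuous; rewrite -derivable1_diffP.
  by have [] := dq _ Dl.
have mD : measurable D by exact: measurable_itv.
have mq : measurable_fun setT q.
  by apply: measurable_sqrtr; apply: measurable_funB => //; exact: measurable_funX.
have qsurj y : 0 < y -> exists2 l, D l & q l = y.
  move=> y0; exists (Num.sqrt (y ^+ 2 + h ^+ 2)).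
    rewrite /D/= in_itv/= andbT -[ltLHS](gtr0_norm h0) -sqrtr_sqr.
    by rewrite ltr_sqrt ?ltrDr ?exprn_gt0// addr_gt0// exprn_gt0.
  rewrite /q sqr_sqrtr ?addr_ge0 ?sqr_ge0// addrK sqrtr_sqr gtr0_norm//.
pose p1 l := r0 + q l; pose p2 l := r0 - q l.
have im1 : p1 @` D = `]r0, +oo[%classic.
  apply/seteqP; split=> r /=; rewrite in_itv/= andbT.
    by move=> [l Dl <-]; rewrite ltrDl q0.
  move=> r0r; have [|l Dl ql] := qsurj (r - r0); first by rewrite subr_gt0.
  by exists l => //; rewrite /p1 ql addrC subrK.
have im2 : p2 @` D = `]-oo, r0[%classic.
  apply/seteqP; split=> r /=; rewrite in_itv/=.
    by move=> [l Dl <-]; rewrite ltrBlDr ltrDl q0.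
  move=> r0r; have [|l Dl ql] := qsurj (r0 - r); first by rewrite subr_gt0.
  by exists l => //; rewrite /p2 ql opprB addrCA subrr addr0.
have dp1 l : D l -> is_derive l 1 p1 (l / q l).
  move=> /dq dl; apply: (is_derive_eq (is_deriveD (is_derive_cst r0 l 1) dl)).
  by rewrite add0r.
have dp2 l : D l -> is_derive l 1 p2 (- (l / q l)).
  move=> /dq dl; apply: (is_derive_eq (is_deriveB (is_derive_cst r0 l 1) dl)).
  by rewrite sub0r.
have lq0 l : D l -> 0 < l / q l.
  by move=> Dl; apply: divr_gt0; [exact: D0|exact: q0].
have pos1 l : D l -> 0 < (-1) ^+ false * (l / q l).
  by move=> Dl; rewrite expr0 mul1r lq0.
have pos2 l : D l -> 0 < (-1) ^+ true * - (l / q l).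
  by move=> Dl; rewrite expr1 mulN1r opprK lq0.
have [_ E1] := ge0_change_of_variables (segment_exhausted_itvoy h) dp1 cq pos1 mG G0.
have [_ E2] := ge0_change_of_variables (segment_exhausted_itvoy h) dp2
  (fun l Dl => continuousN (cq l Dl)) pos2 mG G0.
rewrite -/D im1 in E1; rewrite -/D im2 in E2.
transitivity (\int[mu]_(r in `]-oo, r0[ `|` `]r0, +oo[) G r)%E.
  have -> : `]-oo, r0[ `|` `]r0, +oo[ = [set: R] `\ r0.
    apply/seteqP; split=> r /=; rewrite !in_itv/= andbT.
      by move=> [rr|rr]; split=> // e; move: rr; rewrite e ltxx.
    by move=> [_ /eqP]; rewrite neq_lt => /orP[]; [left|right].
  rewrite integral_setD1//; first exact: measurableD.
  exact: measurable_funTS.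
rewrite ge0_integral_setU//; last 2 first.
- exact: measurable_funTS.
- apply/disj_setPS => r []/=; rewrite !in_itv/= andbT => rlt.
  by move=> /(lt_trans rlt); rewrite ltxx.
rewrite -E1 -E2 -ge0_integralD//; last 4 first.
- by move=> l _; rewrite mule_ge0.
- apply: emeasurable_funM; last apply/measurable_EFinP.
    apply: measurableT_comp => //; apply: measurable_funTS.
    by apply: measurable_funB.
  apply: measurable_funTS; apply: measurableT_comp => //.
  apply: measurableT_comp => //.
  exact: measurable_divr.
- by move=> l _; rewrite mule_ge0.
- apply: emeasurable_funM; last apply/measurable_EFinP.
    apply: measurableT_comp => //; apply: measurable_funTS.
    by apply: measurable_funD.
  apply: measurable_funTS; apply: measurableT_comp => //.
  exact: measurable_divr.
apply: eq_integral => l /[!inE] Dl.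
rewrite normrN gtr0_norm; last exact: lq0.
by rewrite -ge0_muleDl// addeC.
Qed.

Variables (A u C w : R * R) (T : set (R * R)).

(** [C + foot s *: w] is the orthogonal projection of [A + s *: u] on the second
    line, and [height s] is the signed distance between these two points. *)
Definition foot (s : R) : R :=
  - ((chord_vec A u C w s 0).1 * w.1 + (chord_vec A u C w s 0).2 * w.2).

Definition height (s : R) : R := cross (chord_vec A u C w s 0) w.

(** The abscissas at which the circle of radius [l] around [A + s *: u] meets the
    second line. *)
Definition far_end (e : bool) (s l : R) : R :=
  foot s + (-1) ^+ e * Num.sqrt (l ^+ 2 - height s ^+ 2).

(** When [0 <= l <= |height s|] the circle does not cross the line; the square root
    is then [0], and so is the kernel, because the inverse of [0] is [0]. *)
Definition branch_kernel (e : bool) (s l : R) : R :=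
  \1_T (s, far_end e s l) *
  (`|cross (chord_vec A u C w s (far_end e s l)) u| * `|height s| /
     (l ^+ 2 * Num.sqrt (l ^+ 2 - height s ^+ 2))).

Definition chord_kernel (s l : R) : R :=
  branch_kernel false s l + branch_kernel true s l.

Hypothesis mT : measurable T.

Lemma branch_kernel_ge0 e s l : 0 <= branch_kernel e s l.
Proof.
by rewrite /branch_kernel !mulr_ge0// invr_ge0 mulr_ge0 ?sqr_ge0 ?sqrtr_ge0.
Qed.

Lemma chord_kernel_ge0 s l : 0 <= chord_kernel s l.
Proof. by rewrite addr_ge0// branch_kernel_ge0. Qed.

Lemma measurable_height : measurable_fun setT height.
Proof. exact: measurable_cross. Qed.

Lemma measurable_foot : measurable_fun setT foot.
Proof.
apply: measurable_funN; apply: measurable_funD; apply: measurable_funM => //=;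
  by apply: measurable_funB => //; apply: measurable_funD => //; apply: measurable_funM.
Qed.

Lemma measurable_chord_kernel :
  measurable_fun setT (fun z : R * R => chord_kernel z.1 z.2).
Proof.
have m1 : measurable_fun setT (fun l : R * R => l.1) by exact: measurable_fst.
have m2 : measurable_fun setT (fun l : R * R => l.2) by exact: measurable_snd.
have mh : measurable_fun setT (fun z : R * R => height z.1).
  exact: measurableT_comp measurable_height m1.
have mf : measurable_fun setT (fun z : R * R => foot z.1).
  exact: measurableT_comp measurable_foot m1.
have msq : measurable_fun setT (fun z : R * R => Num.sqrt (z.2 ^+ 2 - height z.1 ^+ 2)).
  by apply: measurable_sqrtr; apply: measurable_funB; exact: measurable_funX.
have mfar e : measurable_fun setT (fun z : R * R => far_end e z.1 z.2).
  by apply: measurable_funD => //; apply: measurable_funM.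
by apply: measurable_funD; (apply: measurable_funM;
  [apply: (measurableT_comp (f := \1_T : R * R -> R));
     [exact: measurable_indic|exact: measurable_fun_pair]
  |apply: measurable_divr; apply: measurable_funM => //;
    [apply: measurableT_comp => //; exact: measurable_cross
    |exact: measurableT_comp|exact: measurable_funX]]).
Qed.

Hypothesis unit_w : w.1 ^+ 2 + w.2 ^+ 2 = 1.
Hypothesis transversal : forall s r, T (s, r) ->
  cross (chord_vec A u C w s r) u != 0 /\ cross (chord_vec A u C w s r) w != 0.

Lemma height_const s r : cross (chord_vec A u C w s r) w = height s.
Proof. by rewrite /height /cross /chord_vec/= /GRing.scale/=; ring. Qed.

Lemma chord_length_sq s r :
  chord_length A u C w s r ^+ 2 = (r - foot s) ^+ 2 + height s ^+ 2.
Proof.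
rewrite sqr_sqrtr ?addr_ge0 ?sqr_ge0//= /foot /height /cross /chord_vec/=.
rewrite /GRing.scale/=.
set a := A.1 + s * u.1; set b := A.2 + s * u.2.
transitivity ((C.1 - a + r * w.1) ^+ 2 + (C.2 - b + r * w.2) ^+ 2); first by ring.
have -> : C.1 + 0 * w.1 - a = C.1 - a by ring.
have -> : C.2 + 0 * w.2 - b = C.2 - b by ring.
move: (C.1 - a) (C.2 - b) unit_w => x y uw.
apply/eqP; rewrite -subr_eq0; apply/eqP.
transitivity ((x ^+ 2 + y ^+ 2 - r ^+ 2) * (1 - (w.1 ^+ 2 + w.2 ^+ 2))).
  by ring.
by rewrite uw subrr mulr0.
Qed.

Lemma chord_length_far_end e s l : 0 < l -> `|height s| <= l ->
  chord_length A u C w s (far_end e s l) = l.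
Proof.
move=> l0 hl; apply/eqP; rewrite -(eqrXn2 (n := 2))// ?sqrtr_ge0 ?ltW//.
rewrite chord_length_sq /far_end addrAC subrr add0r exprMn sqrr_sign mul1r.
rewrite sqr_sqrtr ?subrK// subr_ge0 -real_normK ?num_real//.
by rewrite ler_pXn2r// nnegrE ltW.
Qed.

(** The weight [|v x u| |v x w| / l^3] is multiplied by the derivative
    [l / sqrt (l^2 - height s^2)] of [r] with respect to [l]. *)
Lemma slice_kernel (E : set R) s : measurable E -> E `<=` `]0, +oo[ ->
  (\int[mu]_r (\1_T (s, r) * \1_E (chord_length A u C w s r) *
                 chord_weight A u C w s r)%:E =
   \int[mu]_l ((\1_E l)%:E * (chord_kernel s l)%:E))%E.
Proof.
move=> mE E0; have [h0|h0] := eqVneq (height s) 0.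
  rewrite !integral0_eq// => [l _|r _].
    by rewrite /chord_kernel /branch_kernel h0 normr0 !(mulr0, mul0r) addr0 mule0.
  by rewrite /chord_weight height_const h0 normr0 mulr0 mul0r mulr0.
have nh0 : 0 < `|height s| by rewrite normr_gt0.
rewrite (ge0_integral_hyperbola (foot s) nh0); last 2 first.
- apply/measurable_EFinP; apply: measurable_funM.
    apply: measurable_funM.
      apply: (measurableT_comp (f := \1_T : R * R -> R)).
        exact: measurable_indic.
      exact: measurable_pair1.
    apply: (measurableT_comp (f := \1_E : R -> R)); first exact: measurable_indic.
    exact: measurable_eucl_dist.
  apply: measurable_divr; last by apply: measurable_funX; exact: measurable_eucl_dist.
  by apply: measurable_funM; apply: measurableT_comp => //; exact: measurable_cross.
- by move=> r; rewrite lee_fin !mulr_ge0// invr_ge0 exprn_ge0// sqrtr_ge0.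
rewrite integral_mkcond; apply: eq_integral => l _; rewrite patchE.
rewrite real_normK ?num_real//.
have [lh|] := boolP (l \in _); last first.
  move=> lh; have [lE|lE] := boolP (l \in E); last by rewrite indicE (negbTE lE) mul0e.
  have l0 : 0 < l by move: lE => /set_mem/E0; rewrite /= in_itv/= andbT.
  have lh' : l <= `|height s|.
    by move: lh; rewrite notin_setE/= in_itv/= andbT => /negP; rewrite -leNgt.
  rewrite /chord_kernel /branch_kernel ler0_sqrtr.
    by rewrite !mulr0 invr0 !mulr0 addr0 mule0.
  by rewrite subr_le0 -[leRHS]real_normK ?num_real// ler_pXn2r ?nnegrE// ltW.
have {}lh : `|height s| < l by move: lh; rewrite inE/= in_itv/= andbT.
have l0 : 0 < l by exact: lt_trans lh.
have q0 : 0 < Num.sqrt (l ^+ 2 - height s ^+ 2) by exact: sqrt_sub_sqr_gt0.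
have G e : ((\1_T (s, far_end e s l) * \1_E (chord_length A u C w s (far_end e s l)) *
      chord_weight A u C w s (far_end e s l))%:E *
    (l / Num.sqrt (l ^+ 2 - height s ^+ 2))%:E = (\1_E l * branch_kernel e s l)%:E)%E.
  rewrite /chord_weight chord_length_far_end ?ltW// height_const -EFinM /branch_kernel.
  congr (_%:E); move: q0; set q := Num.sqrt _ => q0.
  by field; rewrite !gt_eqF.
rewrite ge0_muleDl ?lee_fin; last 2 first.
- by rewrite !mulr_ge0// invr_ge0 exprn_ge0// sqrtr_ge0.
- by rewrite !mulr_ge0// invr_ge0 exprn_ge0// sqrtr_ge0.
have := G false; rewrite {1 2 3}/far_end expr0 mul1r => ->.
have := G true; rewrite {1 2 3}/far_end expr1 mulN1r => ->.
by rewrite -EFinD -mulrDr EFinM.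
Qed.

(** Combines [line_measure_joining] with [slice_kernel] on each slice, which trades
    the abscissa [r] for the length; the integrals are then exchanged. *)
Theorem line_measure_kernel (E : set R) : measurable E -> E `<=` `]0, +oo[ ->
  (line_measure (lines_joining A u C w T E) =
   \int[mu]_(l in E) \int[mu]_s (chord_kernel s l)%:E)%E.
Proof.
move=> mE E0; rewrite (line_measure_joining mT mE transversal).
transitivity (\int[mu]_s \int[mu]_l ((\1_E l)%:E * (chord_kernel s l)%:E))%E.
  by apply: eq_integral => s _; exact: slice_kernel.
have mk : measurable_fun setT
    (fun z : R * R => (\1_E z.2)%:E * (chord_kernel z.1 z.2)%:E)%E.
  apply: emeasurable_funM; apply/measurable_EFinP; last exact: measurable_chord_kernel.
  apply: (measurableT_comp (f := \1_E : R -> R)); first exact: measurable_indic.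
  exact: measurable_snd.
rewrite (tonelli_swap mk); last first.
  by move=> s l; rewrite mule_ge0// lee_fin// chord_kernel_ge0.
rewrite [RHS]integral_mkcond; apply: eq_integral => l _; rewrite patchE indicE.
case: ifPn => lE; last by apply: integral0_eq => s _; rewrite mul0e.
by apply: eq_integral => s _; rewrite mul1e.
Qed.

End kernel.

(** * Continuity of the kernel of a segment *)

Section strip_kernel.
Context {R : realType}.
Notation mu := (@lebesgue_measure R).

Lemma finite_quadratic_roots (a b c : R) : a != 0 ->
  finite_set [set x : R | a * x ^+ 2 + b * x + c = 0].
Proof.
move=> a0; pose d := Num.sqrt (b ^+ 2 - 4 * a * c).
apply: (@sub_finite_set _ _ [set (- b + d) / (2 * a); (- b - d) / (2 * a)]); last first.
  exact: finite_set2.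
move=> x /= h.
have sq : (2 * a * x + b) ^+ 2 = b ^+ 2 - 4 * a * c.
  by rewrite -[RHS]addr0 -(mulr0 (4 * a)) -h; ring.
have a20 : 2 * a != 0 by rewrite mulf_neq0// pnatr_eq0.
have d2 : d ^+ 2 = (2 * a * x + b) ^+ 2 by rewrite sq sqr_sqrtr// -sq sqr_ge0.
move/eqP: d2; rewrite eqf_sqr => /orP[/eqP ->|/eqP ->]; [left|right];
  apply: (mulIf a20); rewrite divfK//; ring.
Qed.

Variables (A u C w : R * R).
Hypothesis unit_u : u.1 ^+ 2 + u.2 ^+ 2 = 1.
Hypothesis unit_w : w.1 ^+ 2 + w.2 ^+ 2 = 1.

Notation height := (height A u C w).
Notation foot := (foot A u C w).
Notation far_end := (far_end A u C w).

Let h1 := - cross u w.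
Let f1 := u.1 * w.1 + u.2 * w.2.

Lemma height_affine s : height s = height 0 + s * - cross u w.
Proof. by rewrite /height /cross /chord_vec/= /GRing.scale/=; ring. Qed.

Lemma foot_affine s : foot s = foot 0 + s * (u.1 * w.1 + u.2 * w.2).
Proof. by rewrite /foot /chord_vec/= /GRing.scale/=; ring. Qed.

(** [height] and [foot] are affine in [s] with slopes [h1] and [f1], the components
   of [u] in an orthonormal frame along the second line. *)
Let slopes : f1 ^+ 2 + h1 ^+ 2 = 1.
Proof.
rewrite /f1 /h1 /cross.
transitivity ((u.1 ^+ 2 + u.2 ^+ 2) * (w.1 ^+ 2 + w.2 ^+ 2)); first by ring.
by rewrite unit_u unit_w mulr1.
Qed.

(** By [slopes] this is a quadratic equation with leading coefficient [1]. *)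
Lemma finite_sphere (r l : R) :
  finite_set [set s | chord_length A u C w s r ^+ 2 = l ^+ 2].
Proof.
apply: sub_finite_set (finite_quadratic_roots
  (2 * (height 0 * h1 + (foot 0 - r) * f1))
  ((foot 0 - r) ^+ 2 + height 0 ^+ 2 - l ^+ 2) (oner_neq0 R)) => s /=.
rewrite chord_length_sq// height_affine foot_affine -/h1 -/f1 => h.
by rewrite -[X in X * s ^+ 2]slopes -h; ring.
Qed.

Lemma finite_tangent (l : R) : cross u w != 0 ->
  finite_set [set s | height s ^+ 2 = l ^+ 2].
Proof.
move=> uw0; have h10 : h1 ^+ 2 != 0 by rewrite sqrf_eq0 oppr_eq0.
apply: sub_finite_set (finite_quadratic_roots
  (2 * height 0 * h1) (height 0 ^+ 2 - l ^+ 2) h10) => s /=.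
by rewrite height_affine -/h1 => <-; ring.
Qed.

Definition strip (b : R) : set (R * R) := [set z | 0 <= z.2 <= b].

Lemma measurable_strip b : measurable (strip b).
Proof.
have -> : strip b = snd @^-1` `[0, b] by apply/seteqP; split=> z; rewrite /strip/= in_itv.
by rewrite -[X in measurable X]setTI; apply: measurable_snd.
Qed.

Notation kernel b := (chord_kernel A u C w (strip b)).

Lemma branch_kernel_out (T : set (R * R)) e s l : 0 <= l -> l <= `|height s| ->
  branch_kernel A u C w T e s l = 0.
Proof.
move=> l0 lh; rewrite /branch_kernel ler0_sqrtr ?mulr0 ?invr0 ?mulr0//.
by rewrite subr_le0 -[leRHS]real_normK ?num_real// ler_pXn2r ?nnegrE// ltW.
Qed.

Lemma kernel_out T s l : 0 <= l -> l <= `|height s| ->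
  chord_kernel A u C w T s l = 0.
Proof. by move=> l0 lh; rewrite /chord_kernel !branch_kernel_out// addr0. Qed.

Lemma continuous_height : continuous height.
Proof.
move=> s; rewrite (_ : height = fun s => height 0 + s * - cross u w); last first.
  by apply/funext => x; exact: height_affine.
by apply: cvgD; [exact: cvg_cst|apply: cvgM; [exact: cvg_id|exact: cvg_cst]].
Qed.

Lemma continuous_foot : continuous foot.
Proof.
move=> s; rewrite (_ : foot = fun s => foot 0 + s * (u.1 * w.1 + u.2 * w.2)); last first.
  by apply/funext => x; exact: foot_affine.
by apply: cvgD; [exact: cvg_cst|apply: cvgM; [exact: cvg_id|exact: cvg_cst]].
Qed.

(** The kernel of the segment from [C] to [C + b *: w] is continuous at [(s, l)]
    unless the circle of radius [l] around [A + s *: u] is tangent to the second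
    line or passes through an end of the segment. It is stated along a filter
    because it serves in the variable [s], and along curves in [(s, l)]. *)
Lemma cvg_kernel (X : Type) (F : set_system X) (FF : Filter F) (s_ l_ : X -> R)
    (b s l : R) : 0 < l -> `|height s| != l ->
  chord_length A u C w s 0 ^+ 2 != l ^+ 2 ->
  chord_length A u C w s b ^+ 2 != l ^+ 2 ->
  s_ x @[x --> F] --> s -> l_ x @[x --> F] --> l ->
  kernel b (s_ x) (l_ x) @[x --> F] --> kernel b s l.
Proof.
move=> l0 hl n0 nb cs cl.
have ch : height (s_ x) @[x --> F] --> height s.
  exact: (continuous_cvg FF (@continuous_height s) cs).
have cf : foot (s_ x) @[x --> F] --> foot s.
  exact: (continuous_cvg FF (@continuous_foot s) cs).
have cnh : `|height (s_ x)| @[x --> F] --> `|height s| by exact: cvg_norm.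
move: hl; rewrite neq_lt => /orP[hl|lh]; last first.
  rewrite kernel_out ?ltW//; apply: cvg_near_cst.
  near=> x; apply: kernel_out; apply/ltW.
    by near: x; exact: (cvgr_gt _ cl).
  near: x; have : `|height (s_ x)| - l_ x @[x --> F] --> `|height s| - l by exact: cvgB.
  move=> /cvgr_gt/(_ 0); rewrite subr_gt0 => /(_ lh); apply: filterS => x.
  by rewrite subr_gt0.
have q0 : 0 < Num.sqrt (l ^+ 2 - height s ^+ 2) by exact: sqrt_sub_sqr_gt0.
have cq : Num.sqrt (l_ x ^+ 2 - height (s_ x) ^+ 2) @[x --> F] -->
    Num.sqrt (l ^+ 2 - height s ^+ 2).
  apply: (continuous_cvg FF (@sqrt_continuous R _)).
  by apply: cvgB; rewrite !expr2; under eq_fun do rewrite expr2; apply: cvgM.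
have cr e : far_end e (s_ x) (l_ x) @[x --> F] --> far_end e s l.
  by apply: cvgD => //; apply: cvgM => //; exact: cvg_cst.
have r_neq e c : chord_length A u C w s c ^+ 2 != l ^+ 2 -> far_end e s l != c.
  apply: contra => /eqP <-; rewrite chord_length_far_end// ltW//.
suff cb e : branch_kernel A u C w (strip b) e (s_ x) (l_ x) @[x --> F] -->
    branch_kernel A u C w (strip b) e s l by apply: cvgD.
apply: cvgM.
  apply: cvg_near_cst.
  have near_le (c : R) (y_ : X -> R) (y : R) : y_ x @[x --> F] --> y -> y != c ->
      (\forall x \near F, (c <= y_ x) = (c <= y)) /\
      (\forall x \near F, (y_ x <= c) = (y <= c)).
    move=> cy; rewrite neq_lt => /orP[yc|cy0]; split; near=> x.
    - by rewrite (lt_geF yc) lt_geF//; near: x; exact: (cvgr_lt _ cy).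
    - by rewrite (ltW yc) ltW//; near: x; exact: (cvgr_lt _ cy).
    - by rewrite (ltW cy0) ltW//; near: x; exact: (cvgr_gt _ cy).
    - by rewrite (lt_geF cy0) lt_geF//; near: x; exact: (cvgr_gt _ cy).
  have stripE s' r' : \1_(strip b) (s', r') = (0 <= r' <= b)%R%:R :> R.
    rewrite indicE; congr ((nat_of_bool _)%:R).
    by apply/idP/idP => [/set_mem//|h]; exact/mem_set.
  have [h0 _] := near_le _ _ _ (cr e) (r_neq e _ n0).
  have [_ hb] := near_le _ _ _ (cr e) (r_neq e _ nb).
  near=> x; rewrite !stripE; congr ((nat_of_bool (_ && _))%:R).
    by near: x.
  by near: x.
apply: cvgM; first (apply: cvgM; apply: cvg_norm => //).
  rewrite /cross; apply: cvgB; apply: cvgM; rewrite /chord_vec/= /GRing.scale/=;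
    first [exact: cvg_cst|apply: cvgB; apply: cvgD;
      first [exact: cvg_cst|apply: cvgM; first [exact: cvg_cst|exact: cr|exact: cs]]].
apply: cvgV; first by rewrite mulf_neq0 ?gt_eqF// exprn_gt0.
by apply: cvgM => //; rewrite expr2; under eq_fun do rewrite expr2; apply: cvgM.
Unshelve. all: by end_near. Qed.

End strip_kernel.

(** * Integrals of the kernel over a segment *)

Section integration_lemmas.
Context {R : realType}.
Notation mu := (@lebesgue_measure R).

Lemma ge0_integral_shift (f : R -> \bar R) (c : R) :
  measurable_fun setT f -> (forall x, 0 <= f x)%E ->
  (\int[mu]_x f x = \int[mu]_x f (x + c)%R)%E.
Proof.
move=> mf f0.
have d (x : R) : setT x -> is_derive x 1 (fun y => y + c) (1 : R).
  by move=> _; apply: is_derive_eq; rewrite addr0.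
have cd (x : R) : setT x -> {for x, continuous (fun=> 1 : R)}.
  by move=> _; exact: cst_continuous.
have p (x : R) : setT x -> 0 < (-1) ^+ false * (1 : R) by rewrite expr0 mul1r.
have [_] := ge0_change_of_variables segment_exhausted_setT d cd p mf f0.
have -> : (fun y => y + c) @` setT = setT.
  by apply/seteqP; split=> // y _; exists (y - c) => //; rewrite subrK.
by move=> <-; apply: eq_integral => x _; rewrite normr1 mule1.
Qed.

(** The substitution [y^2 = c0 + c1 * x] turns the integrand into a constant. *)
Lemma integral_inv_sqrt_lty (c0 c1 b1 b2 : R) : c1 != 0 ->
  (\int[mu]_x ((Num.sqrt (c0 + c1 * x))^-1 * \1_(`[b1, b2]%classic) x)%:E < +oo)%E.
Proof.
move=> c10.
pose f (x : R) := ((Num.sqrt (c0 + c1 * x))^-1 * \1_(`[b1, b2]%classic) x)%:E.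
rewrite -/f.
have f0 x : (0 <= f x)%E by rewrite lee_fin mulr_ge0// invr_ge0 sqrtr_ge0.
have mf : measurable_fun setT f.
  apply/measurable_EFinP; apply: measurable_funM; last exact: measurable_indic.
  apply: (measurableT_comp measurable_invr); apply: measurable_sqrtr.
  by apply: measurable_funD => //; apply: measurable_funM.
pose phi x := (x ^+ 2 - c0) / c1; pose dphi x := 2 * x / c1.
pose D : set R := `]0, +oo[%classic.
have D0 x : D x -> 0 < x by rewrite /D/= in_itv/= andbT.
have d (x : R) : D x -> is_derive x 1 phi (dphi x).
  by move=> _; apply: is_derive_eq; rewrite /dphi /GRing.scale/=; ring.
have cd (x : R) : D x -> {for x, continuous dphi}.
  move=> _; apply: cvgM; last exact: cvg_cst.
  by apply: cvgM; [exact: cvg_cst|exact: cvg_id].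
have p (x : R) : D x -> 0 < (-1) ^+ (c1 < 0)%R * dphi x.
  move=> /D0 x0; rewrite /dphi mulrCA pmulr_rgt0; last exact: mulr_gt0.
  move: c10; case: (ltgtP c1 0) => // c1s _.
    by rewrite expr1 mulN1r oppr_gt0 invr_lt0.
  by rewrite expr0 mul1r invr_gt0.
have [mI E] := ge0_change_of_variables (segment_exhausted_itvoy 0) d cd p mf f0.
rewrite -/D in mI E.
have -> : (\int[mu]_x f x = \int[mu]_(x in phi @` D) f x)%E.
  rewrite [RHS]integral_mkcond; apply: eq_integral => x _; rewrite patchE.
  case: ifPn => // /negP xI; rewrite /f ler0_sqrtr ?invr0 ?mul0r//.
  rewrite leNgt; apply/negP => z0; apply: xI; apply/mem_set.
  exists (Num.sqrt (c0 + c1 * x)); first by rewrite /D/= in_itv/= andbT sqrtr_gt0.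
  by rewrite /phi sqr_sqrtr ?ltW// addrC addKr mulrC mulKf.
rewrite -E.
pose M := `|c0| + `|c1| * (`|b1| + `|b2|) + 1.
have M1 : 1 <= M by rewrite lerDr addr_ge0// mulr_ge0// addr_ge0.
have le_bound x : D x -> (f (phi x) * `|dphi x|%:E <=
    (2 / `|c1|)%:E * (\1_(`[0, M]%classic : set R) x)%:E)%E.
  move=> /D0 x0; rewrite /f -!EFinM lee_fin.
  have -> : c0 + c1 * phi x = x ^+ 2.
    by rewrite /phi mulrC divfK// addrC subrK.
  rewrite sqrtr_sqr gtr0_norm// /dphi !normrM normfV (gtr0_norm x0) gtr0_norm//.
  rewrite [leLHS](_ : _ = (2 / `|c1|) * \1_(`[b1, b2]%classic) (phi x)); last first.
    by field; rewrite normr_eq0 c10 gt_eqF.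
  rewrite ler_wpM2l ?divr_ge0//.
  rewrite !indicE ler_nat; have [h|//] := boolP (phi x \in _).
  rewrite mem_set//=; move: h; rewrite inE/= !in_itv/= => /andP[p1 p2].
  rewrite ltW//=.
  have px : `|phi x| <= `|b1| + `|b2|.
    rewrite ler_norml; apply/andP; split.
      apply: le_trans p1; have := ler_norm (- b1); rewrite normrN => ?.
      by have := normr_ge0 b2; lra.
    by apply: (le_trans p2); have := ler_norm b2; have := normr_ge0 b1; lra.
  have x2 : x ^+ 2 <= M.
    have -> : x ^+ 2 = c0 + c1 * phi x by rewrite /phi mulrC divfK// addrC subrK.
    apply: (le_trans (ler_norm _)); apply: (le_trans (ler_normD _ _)).
    rewrite normrM /M -addrA lerD2l ler_wpDr// ler_wpM2l//.
  have [xM|//] := ltrP M x.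
  have : M * M <= x ^+ 2 by rewrite expr2 ler_pM// ?ltW//; lra.
  by nra.
apply: (@le_lt_trans _ _ (\int[mu]_(x in D)
    ((2 / `|c1|)%:E * (\1_(`[0, M]%classic : set R) x)%:E))%E).
  apply: ge0_le_integral => //.
  - exact: measurable_itv.
  - by move=> x _; rewrite mule_ge0.
  - apply: emeasurable_funM.
      apply: (measurable_funS measurableT) => //.
      apply: measurableT_comp => //; apply: measurable_funM => //.
      by apply: measurable_funB => //; exact: measurable_funX.
    apply/measurable_EFinP; apply: measurableT_comp => //.
    by apply: measurable_funM => //; exact: measurable_funM.
  - apply: measurable_funeM; apply/measurable_EFinP.
    exact: measurable_indic.
have c1i0 : 0 <= 2 / `|c1| by rewrite divr_ge0.
have mi : measurable_fun D (fun x => (\1_(`[0, M]%classic : set R) x)%:E : \bar R).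
  by apply/measurable_EFinP; exact: measurable_indic.
rewrite ge0_integralZl//; last exact: measurable_itv.
rewrite integral_indic//; last exact: measurable_itv. apply: lte_mul_pinfty => //.
apply: (@le_lt_trans _ _ (mu `[0, M]%classic)).
  apply: le_measure; rewrite ?inE//.
  by apply: measurableI => //; exact: measurable_itv.
by rewrite lebesgue_measure_itv/=; case: ifP => // _; rewrite -EFinB ltry.
Qed.

End integration_lemmas.

Section chord_integral.
Context {R : realType}.
Notation mu := (@lebesgue_measure R).
Variables (A u C w : R * R).
Hypothesis unit_u : u.1 ^+ 2 + u.2 ^+ 2 = 1.
Hypothesis unit_w : w.1 ^+ 2 + w.2 ^+ 2 = 1.

Notation height := (height A u C w).
Notation kernel b := (chord_kernel A u C w (strip b)).

Let bound (b : R) := `|cross (C - A) u| + b * `|cross w u|.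

Let bound_ge0 b : 0 <= b -> 0 <= bound b.
Proof. by move=> b0; rewrite addr_ge0// mulr_ge0. Qed.

Lemma kernel_le b s l : 0 <= b -> 0 < l ->
  kernel b s l <= 2 * bound b / (l * Num.sqrt (l ^+ 2 - height s ^+ 2)).
Proof.
move=> b0 l0; have [lh|hl] := lerP l `|height s|.
  rewrite kernel_out ?(ltW l0)//.
  by rewrite divr_ge0 ?mulr_ge0 ?bound_ge0 ?sqrtr_ge0// ltW.
have q0 : 0 < Num.sqrt (l ^+ 2 - height s ^+ 2) by exact: sqrt_sub_sqr_gt0.
suff H e : branch_kernel A u C w (strip b) e s l <=
    bound b / (l * Num.sqrt (l ^+ 2 - height s ^+ 2)).
  by rewrite -mulrA mulr_natl mulr2n; apply: lerD.
rewrite /branch_kernel indicE.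
have [h|h] := boolP (_ \in _); last first.
  by rewrite mul0r divr_ge0 ?bound_ge0// mulr_ge0// ltW.
rewrite mul1r; move: q0; set q := Num.sqrt _ => q0.
have crossB : `|cross (chord_vec A u C w s (far_end A u C w e s l)) u| <= bound b.
  have -> : cross (chord_vec A u C w s (far_end A u C w e s l)) u =
      cross (C - A) u + far_end A u C w e s l * cross w u.
    by rewrite /cross /chord_vec/= /GRing.scale/=; ring.
  apply: (le_trans (ler_normD _ _)); rewrite lerD2l normrM ler_wpM2r//.
  by move: h => /set_mem/=/andP[r0 rb]; rewrite ger0_norm.
rewrite [leLHS](_ : _ = `|cross (chord_vec A u C w s (far_end A u C w e s l)) u| *
  (`|height s| / l) / (l * q)); last by field; rewrite !gt_eqF.
apply: ler_wpM2r; first by rewrite invr_ge0 mulr_ge0// ltW.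
rewrite -[leRHS]mulr1 ler_pM//.
  by rewrite divr_ge0// ltW.
by rewrite ler_pdivrMr// mul1r ltW.
Qed.

Variables (a1 a2 : R) (e : bool).
Hypothesis height_sign : forall s, a1 <= s <= a2 -> 0 < (-1) ^+ e * height s.

Let sg : R := (-1) ^+ e.

(** With [s = tau + shift * l] the singularity [l = |height s|] of the kernel
    stays at a fixed place of the [tau]-axis when [l] varies; for parallel lines
    [height] is constant and [shift] is zero. *)
Definition shift : R := (sg * - cross u w)^-1.

(** The domination needed to let [l] vary. When the lines are secant,
    [l - |height s|] is an affine function of [tau] alone, and
    [sqrt (l^2 - height s^2)] is bounded below by a multiple of its square root.
    When they are parallel, [height] is constant and [l] stays away from it. *)
Lemma kernel_dominated b l : 0 <= b -> 0 < l ->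
  (cross u w = 0 -> `|height 0| != l) ->
  exists g : R -> R, exists d : R,
    [/\ 0 < d, (forall t, 0 <= g t), measurable_fun setT g,
     (\int[mu]_t (g t)%:E < +oo)%E &
     forall l' t, `|l' - l| < d -> 0 < l' /\
       (a1 <= t + shift * l' <= a2 -> kernel b (t + shift * l') l' <= g t)].
Proof.
move=> b0 l0 hl.
have heightE s : height s = height 0 + s * - cross u w by exact: height_affine.
have [uw0|uw0] := eqVneq (cross u w) 0.
  have hE s : height s = height 0 by rewrite heightE uw0 oppr0 mulr0 addr0.
  have shift0 : shift = 0 by rewrite /shift uw0 oppr0 mulr0 invr0.
  have := hl uw0; rewrite neq_lt => /orP[hl0|lh0]; last first.
    exists (fun=> 0), (Num.min l (`|height 0| - l)); split => //.
    - by rewrite lt_min l0 subr_gt0.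
    - by rewrite integral0.
    move=> l' t; rewrite lt_min !ltr_distl => /andP[/andP[l'0 _] /andP[_ l'h]].
    rewrite subrr in l'0; split => // _.
    by rewrite kernel_out ?hE; lra.
  pose m := (l + `|height 0|) / 2.
  have m0 : 0 < m by rewrite /m; have := normr_ge0 (height 0); lra.
  have hm : `|height 0| < m by rewrite /m; lra.
  pose q := Num.sqrt (m ^+ 2 - height 0 ^+ 2).
  have q0 : 0 < q by exact: sqrt_sub_sqr_gt0.
  pose M := 2 * bound b / (m * q).
  have M0 : 0 <= M by apply: divr_ge0; rewrite mulr_ge0 ?bound_ge0// ltW.
  exists (fun t => M * \1_(`[a1, a2]%classic : set R) t), (l - m); split.
  - by rewrite /m; lra.
  - by move=> t; rewrite mulr_ge0.
  - by apply: measurable_funM => //; exact: measurable_indic.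
  - under eq_integral do rewrite EFinM.
    have mi : measurable_fun setT (fun t => (\1_(`[a1, a2]%classic : set R) t)%:E : \bar R).
      by apply/measurable_EFinP; exact: measurable_indic.
    rewrite ge0_integralZl//.
    rewrite integral_indic// setIT; apply: lte_mul_pinfty => //.
    by rewrite /= lebesgue_measure_itv/=; case: ifP => // _; rewrite -EFinB ltry.
  move=> l' t; rewrite ltr_distl => /andP[l'm _].
  have {}l'm : m < l' by lra.
  have l'0 : 0 < l' by exact: lt_trans l'm.
  split=> //; rewrite shift0 mul0r addr0 => ta.
  rewrite indicE mem_set ?mulr1 /= ?in_itv//.
  apply: (le_trans (kernel_le _ b0 l'0)); rewrite /M ler_wpM2l ?mulr_ge0 ?bound_ge0//.
  have qq : q <= Num.sqrt (l' ^+ 2 - height t ^+ 2).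
    by rewrite ler_wsqrtr// hE lerD2r ler_pXn2r ?nnegrE // ltW.
  have qq0 := lt_le_trans q0 qq.
  rewrite lef_pV2 ?posrE; [|exact: mulr_gt0|exact: mulr_gt0].
  by apply: ler_pM => //; exact: ltW.
pose c1 := - (sg * - cross u w); pose c0 := - (sg * height 0).
have c10 : c1 != 0 by rewrite oppr_eq0 mulf_neq0 ?signr_eq0// oppr_eq0.
pose m := l / 2; have m0 : 0 < m by rewrite /m; lra.
pose k := `|shift| * (2 * l).
have k0 : 0 <= k by rewrite mulr_ge0// mulr_ge0// ltW.
pose M := 2 * bound b / (m * Num.sqrt m).
have qm0 : 0 < Num.sqrt m by rewrite sqrtr_gt0.
have M0 : 0 <= M by apply: divr_ge0; rewrite mulr_ge0 ?bound_ge0// ltW.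
exists (fun t => M * ((Num.sqrt (c0 + c1 * t))^-1 *
  \1_(`[a1 - k, a2 + k]%classic : set R) t)), m.
split => //.
- by move=> t; rewrite mulr_ge0// mulr_ge0// invr_ge0 sqrtr_ge0.
- apply: measurable_funM => //; apply: measurable_funM; last exact: measurable_indic.
  apply: (measurableT_comp measurable_invr); apply: measurable_sqrtr.
  by apply: measurable_funD => //; apply: measurable_funM.
- under eq_integral do rewrite EFinM.
  have mi : measurable_fun setT (fun t => ((Num.sqrt (c0 + c1 * t))^-1 *
      \1_(`[a1 - k, a2 + k]%classic : set R) t)%:E : \bar R).
    apply/measurable_EFinP; apply: measurable_funM; last exact: measurable_indic.
    apply: (measurableT_comp measurable_invr); apply: measurable_sqrtr.
    by apply: measurable_funD => //; apply: measurable_funM.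
  rewrite ge0_integralZl//.
  by apply: lte_mul_pinfty => //; exact: integral_inv_sqrt_lty.
move=> l' t; rewrite ltr_distl => /andP[ml' l'm].
have {}ml' : m < l' by move: ml'; rewrite /m; lra.
have {}l'm : l' < 2 * l by move: l'm; rewrite /m; lra.
have l'0 : 0 < l' by exact: lt_trans ml'.
split => // ta.
pose z := c0 + c1 * t; rewrite -/z.
have nhE : `|height (t + shift * l')| = l' - z.
  have := height_sign ta; rewrite -/sg => sh.
  have -> : `|height (t + shift * l')| = sg * height (t + shift * l').
    by rewrite -[RHS]gtr0_norm// normrM normr_sign mul1r.
  rewrite heightE /z /c0 /c1 /shift.
  have : sg * - cross u w != 0 by rewrite mulf_neq0 ?signr_eq0// oppr_eq0.
  rewrite mulrN => sc0.
  by field; move: sc0; rewrite oppr_eq0 mulf_eq0 negb_or => /andP[-> ->].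
have [z0|z0] := lerP z 0.
  rewrite kernel_out ?(ltW l'0)// ?nhE; last by lra.
  by rewrite mulr_ge0// mulr_ge0// invr_ge0 sqrtr_ge0.
rewrite indicE mem_set ?mulr1; last first.
  rewrite /= in_itv/=.
  have : `|shift * l'| <= k by rewrite normrM ler_wpM2l// gtr0_norm// ltW.
  by rewrite ler_norml; lra.
apply: (le_trans (kernel_le _ b0 l'0)).
rewrite /M -[leRHS]mulrA ler_wpM2l ?mulr_ge0 ?bound_ge0// -invfM.
have nh0 := normr_ge0 (height (t + shift * l')).
have qq : Num.sqrt m * Num.sqrt z <= Num.sqrt (l' ^+ 2 - height (t + shift * l') ^+ 2).
  rewrite -sqrtrM ?(ltW m0)//; apply: ler_wsqrtr.
  rewrite -[X in _ - X]real_normK ?num_real// nhE.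
  by move: nh0; rewrite nhE => ?; nra.
have qz0 : 0 < Num.sqrt z by rewrite sqrtr_gt0.
have qq0 := lt_le_trans (mulr_gt0 qm0 qz0) qq.
rewrite lef_pV2 ?posrE; [|exact: mulr_gt0|by rewrite !mulr_gt0].
by rewrite -mulrA; apply: ler_pM => //; rewrite ?mulr_ge0// ltW.
Qed.

End chord_integral.

Section sequential_continuity.
Context {R : realType}.

(** Sequential continuity, where the sequences may be confined to a given
    neighbourhood: the other terms are finitely many. *)
Lemma continuous_for_seq (f : R -> R) (l : R) (P : set R) : nbhs l P ->
  (forall v : R^nat, (forall n, P (v n)) -> v n @[n --> \oo] --> l ->
     f (v n) @[n --> \oo] --> f l) ->
  {for l, continuous f}.
Proof.
move=> Pl H; apply/continuous_withinNx/cvgr_dnbhsP => v [_ vl].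
pose v' n := if `[< P (v n) >] then v n else l.
have v'E : \forall n \near \oo, v' n = v n.
  near=> n; rewrite /v' ifT//; apply/asboolP; near: n; exact: vl.
have /(H v') : forall n, P (v' n).
  by move=> n; rewrite /v'; case: asboolP => // _; exact: nbhs_singleton.
have v'l : v' n @[n --> \oo] --> l.
  by apply: cvg_trans vl; apply: near_eq_cvg; near=> n; rewrite (near v'E n).
move=> /(_ v'l); apply: cvg_trans; apply: near_eq_cvg.
by near=> n; rewrite (near v'E n).
Unshelve. all: by end_near. Qed.

End sequential_continuity.

Section chord_integral.
Context {R : realType}.
Notation mu := (@lebesgue_measure R).
Variables (A u C w : R * R).
Hypothesis unit_u : u.1 ^+ 2 + u.2 ^+ 2 = 1.
Hypothesis unit_w : w.1 ^+ 2 + w.2 ^+ 2 = 1.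

Notation height := (height A u C w).
Notation kernel b := (chord_kernel A u C w (strip b)).

Variables (a1 a2 : R) (e : bool).
Hypothesis height_sign : forall s, a1 <= s <= a2 -> 0 < (-1) ^+ e * height s.

Notation shift := (shift u w e).

Let I : set R := `[a1, a2]%classic.
Let mI : measurable I. Proof. exact: measurable_itv. Qed.

Let kI b l s : R := kernel b s l * \1_I s.

Let measurable_kernel b l : measurable_fun setT (fun s => kernel b s l).
Proof.
have mk := measurable_chord_kernel A u C w (measurable_strip b).
exact: (measurableT_comp mk (measurable_pair2 l)).
Qed.

Let measurable_kI b l : measurable_fun setT (kI b l).
Proof.
by apply: measurable_funM; [exact: measurable_kernel|exact: measurable_indic].
Qed.

Let kI_ge0 b l s : 0 <= kI b l s.
Proof. by rewrite mulr_ge0// chord_kernel_ge0. Qed.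

Let integral_kI b l c :
  (\int[mu]_(s in I) (kernel b s l)%:E = \int[mu]_t (kI b l (t + c))%:E)%E.
Proof.
rewrite integral_mkcond [LHS](ge0_integral_shift c); last 2 first.
- apply/(measurable_restrictT _ _).1; first exact: mI.
  by apply/measurable_EFinP; apply: measurable_funTS; exact: measurable_kernel.
- by move=> s; rewrite patchE; case: ifP => // _; rewrite lee_fin chord_kernel_ge0.
apply: eq_integral => t _; rewrite patchE /kI indicE.
by case: ifP; rewrite ?mulr1 ?mulr0.
Qed.

Lemma integrable_kernel b l : 0 <= b -> 0 < l ->
  mu.-integrable I (fun s => (kernel b s l)%:E).
Proof.
move=> b0 l0; apply/integrableP; split.
  by apply/measurable_EFinP; apply: measurable_funTS; exact: measurable_kernel.
under eq_integral do rewrite gee0_abs ?lee_fin ?chord_kernel_ge0//.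
have [/andP[/eqP uw0 /eqP hl]|] := boolP ((cross u w == 0) && (`|height 0| == l)).
  rewrite integral0_eq// => s _.
  by rewrite kernel_out ?(ltW l0)// height_affine uw0 oppr0 mulr0 addr0 hl.
rewrite negb_and => hl.
have [|g [d [d0 g0 mg ig gk]]] := kernel_dominated height_sign b0 l0.
  by move=> uw0; move: hl; rewrite uw0 eqxx.
rewrite (integral_kI _ _ (shift * l)); apply: le_lt_trans ig.
apply: ge0_le_integral => //.
- by move=> t _; rewrite lee_fin.
- by apply/measurable_EFinP; apply: measurableT_comp => //; exact: measurable_funD.
- exact/measurable_EFinP.
- move=> t _; rewrite lee_fin /kI indicE.
  have [tI|_] := boolP (_ \in I); last by rewrite mulr0.
  rewrite mulr1; have [|_ kg] := gk l t; first by rewrite subrr normr0.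
  by apply: kg; move/set_mem: tI; rewrite /I/= in_itv.
Qed.

(** Dominated convergence after the translation [s = tau + shift * l], which fixes
    the singularity of the kernel. *)
Theorem continuous_chord_integral b l : 0 <= b -> 0 < l ->
  (cross u w = 0 -> `|height 0| != l) ->
  {for l, continuous (fun l' => \int[mu]_(s in I) kernel b s l')}.
Proof.
move=> b0 l0 hl.
have [g [d [d0 g0 mg ig gk]]] := kernel_dominated height_sign b0 l0 hl.
apply: (@continuous_for_seq _ _ _ [set l' | `|l' - l| < d]).
  by apply/nbhs_ballP; exists d => // y; rewrite /ball/= distrC.
move=> v vd vl.
have vint n : (\int[mu]_(s in I) (kernel b s (v n))%:E =
    \int[mu]_t (kI b (v n) (t + shift * v n))%:E)%E by exact: integral_kI.
have lint : (\int[mu]_(s in I) (kernel b s l)%:E =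
    \int[mu]_t (kI b l (t + shift * l))%:E)%E by exact: integral_kI.
apply: fine_cvg; rewrite fineK; last first.
  by apply: integrable_fin_num => //; exact: integrable_kernel.
rewrite (funext vint) lint.
(* The abscissas at which the integrand is not continuous in [l]. *)
pose bad : set R := [set a1; a2] `|` [set s | chord_length A u C w s 0 ^+ 2 = l ^+ 2]
  `|` [set s | chord_length A u C w s b ^+ 2 = l ^+ 2]
  `|` [set s | `|height s| = l].
have fin_bad : finite_set bad.
  rewrite /bad !finite_setU; do !split; try exact: finite_set1.
  - exact: finite_sphere.
  - exact: finite_sphere.
  - have [uw0|uw0] := eqVneq (cross u w) 0.
      rewrite (_ : [set _ | _] = set0); first exact: finite_set0.
      apply/seteqP; split=> // s /=.
      by rewrite height_affine uw0 oppr0 mulr0 addr0 => /eqP; apply/negP/hl.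
    apply: sub_finite_set (finite_tangent A C l uw0) => s /= <-.
    by rewrite real_normK// num_real.
have [] // := @dominated_convergence _ (measurableTypeR R) R mu setT measurableT
  (fun n t => (kI b (v n) (t + shift * v n))%:E)
  (fun t => (kI b l (t + shift * l))%:E) (fun t => (g t)%:E).
- move=> n; apply/measurable_EFinP; apply: measurableT_comp => //.
  exact: measurable_funD.
- by apply/measurable_EFinP; apply: measurableT_comp => //; exact: measurable_funD.
- have cbad : countable ((fun s => s - shift * l) @` bad).
    by apply: finite_set_countable; exact: finite_image.
  exists ((fun s => s - shift * l) @` bad); split.
  + exact: countable_measurable.
  + exact: countable_lebesgue_measure0.
  move=> t /= h; apply: contrapT => tb; apply: h => _.
  pose s := t + shift * l.
  have sb : ~ bad s by move=> sb; apply: tb; exists s => //; rewrite /s addrK.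
  have cs : t + shift * v n @[n --> \oo] --> s.
    by apply: cvgD; [exact: cvg_cst|apply: cvgM => //; exact: cvg_cst].
  apply: cvg_EFin; first exact: nearW.
  apply: cvgM.
    apply: cvg_kernel => //.
    + by apply/eqP => h; apply: sb; right.
    + by apply/eqP => h; apply: sb; left; left; right.
    + by apply/eqP => h; apply: sb; left; right.
  apply: cvg_near_cst.
  have IE x : \1_I x = (a1 <= x <= a2)%R%:R :> R.
    rewrite indicE; congr ((nat_of_bool _)%:R).
    by apply/idP/idP => [/set_mem|h]; [|apply/mem_set]; rewrite /I/= in_itv.
  have sa1 : s != a1 by apply/eqP => h; apply: sb; left; left; left; left.
  have sa2 : s != a2 by apply/eqP => h; apply: sb; left; left; left; right.
  near=> n; rewrite !IE; congr ((nat_of_bool (_ && _))%:R); near: n.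
  + move: sa1; rewrite neq_lt => /orP[sa|sa]; near=> n.
      by rewrite (lt_geF sa) lt_geF//; near: n; exact: (cvgr_lt _ cs).
    by rewrite (ltW sa) ltW//; near: n; exact: (cvgr_gt _ cs).
  + move: sa2; rewrite neq_lt => /orP[sa|sa]; near=> n.
      by rewrite (ltW sa) ltW//; near: n; exact: (cvgr_lt _ cs).
    by rewrite (lt_geF sa) lt_geF//; near: n; exact: (cvgr_gt _ cs).
- apply/integrableP; split; first exact/measurable_EFinP.
  by under eq_integral do rewrite gee0_abs ?lee_fin//.
- apply: aeW => t n _; rewrite gee0_abs ?lee_fin//.
  rewrite /kI indicE; have [tI|_] := boolP (_ \in I); last by rewrite mulr0.
  rewrite mulr1; have [_ kg] := gk (v n) t (vd n).
  by apply: kg; move/set_mem: tI; rewrite /I/= in_itv.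
Unshelve. all: by end_near. Qed.

(** The right derivative at [t = 0] of the integral over [[s0, s0 + t]], at a point
    of continuity of the integrand. *)
Lemma cvg_mean_kernel b l s0 : 0 <= b -> 0 < l -> a1 <= s0 < a2 ->
  `|height s0| != l -> chord_length A u C w s0 0 ^+ 2 != l ^+ 2 ->
  chord_length A u C w s0 b ^+ 2 != l ^+ 2 ->
  t^-1 * \int[mu]_(s in `[s0, s0 + t]) kernel b s l @[t --> 0^'+] --> kernel b s0 l.
Proof.
move=> b0 l0 /andP[as0 s0a] hl n0 nb.
have ck : kernel b s l @[s --> s0] --> kernel b s0 l.
  by apply: cvg_kernel => //; exact: cvg_cst.
apply/cvgrPdist_le => eps eps0.
move/cvgrPdist_le: ck => /(_ _ eps0)/nbhs_ballP[d /= d0 dk].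
near=> t.
have t0 : 0 < t by [].
have td : t < d by near: t; exact: nbhs_right_lt.
have ta : t < a2 - s0 by near: t; apply: nbhs_right_lt; rewrite subr_gt0.
pose J : set R := `[s0, s0 + t]%classic.
have mJ : measurable J by exact: measurable_itv.
have muJ : mu J = t%:E.
  by rewrite /J lebesgue_measure_itv/= lte_fin ltrDl t0 -EFinB addrC addKr.
have JI : J `<=` I by move=> s; rewrite /J /I/= !in_itv/= => /andP[? ?]; lra.
have ik : mu.-integrable J (EFin \o (fun s => kernel b s l)).
  exact: (@integrableS _ (measurableTypeR R) R mu I J _ mI mJ JI (integrable_kernel b0 l0)).
have ic (c : R) : mu.-integrable J (EFin \o (fun=> c)).
  apply: measurable_bounded_integrable => //; first by rewrite /= muJ ltry.
  by exists `|c|; split => // M cM x _; exact: ltW.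
have iB : mu.-integrable J (EFin \o (fun s => kernel b s0 l - kernel b s l)).
  rewrite (_ : EFin \o _ = (EFin \o (fun=> kernel b s0 l)) \-
    (EFin \o (fun s => kernel b s l)))%E.
    exact: integrableB.
  by apply/funext => s /=; rewrite EFinB.
have ct c : \int[mu]_(s in J) c = c * t by rewrite Rintegral_cst//= muJ.
rewrite -/J.
have -> : kernel b s0 l - t^-1 * \int[mu]_(s in J) kernel b s l =
    t^-1 * \int[mu]_(s in J) (kernel b s0 l - kernel b s l).
  by rewrite RintegralB// ct; field; rewrite gt_eqF.
rewrite normrM gtr0_norm ?invr_gt0// ler_pdivrMl//.
apply: (@le_trans _ _ (\int[mu]_(s in J) `|kernel b s0 l - kernel b s l|)).
  exact: le_normr_Rintegral.
rewrite [leRHS]mulrC -ct; apply: le_Rintegral => //; first exact: integrable_norm.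
move=> s; rewrite /J/= in_itv/= => /andP[s0s st]; apply: dk.
by rewrite /ball/= ltr_norml; lra.
Unshelve. all: by end_near. Qed.

End chord_integral.

(** * The pentagon *)

Section plane_geometry.
Context {R : realType}.
Implicit Types (A B C D V M N x y u w : R * R) (k h m n s r : R).

Lemma pair_ext M N : M.1 = N.1 -> M.2 = N.2 -> M = N.
Proof. by case: M N => [a b] [c d] /= -> ->. Qed.

Lemma cross_coord_inj x y (X Y X' Y' : R) : cross x y != 0 ->
  X *: x + Y *: y = X' *: x + Y' *: y -> X = X' /\ Y = Y'.
Proof.
move=> xy0 E; have := congr1 fst E; have := congr1 snd E.
rewrite /= /GRing.scale/= => e2 e1.
have h1 : (X - X') * cross x y = 0.
  rewrite /cross; transitivity ((X * x.1 + Y * y.1 - (X' * x.1 + Y' * y.1)) * y.2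
    - (X * x.2 + Y * y.2 - (X' * x.2 + Y' * y.2)) * y.1); first by ring.
  by rewrite e1 e2 !subrr !mul0r subrr.
have h2 : (Y - Y') * cross x y = 0.
  rewrite /cross; transitivity ((X * x.2 + Y * y.2 - (X' * x.2 + Y' * y.2)) * x.1
    - (X * x.1 + Y * y.1 - (X' * x.1 + Y' * y.1)) * x.2); first by ring.
  by rewrite e1 e2 !subrr !mul0r subrr.
move/eqP: h1; rewrite mulf_eq0 (negbTE xy0) orbF subr_eq0 => /eqP.
by move/eqP: h2; rewrite mulf_eq0 (negbTE xy0) orbF subr_eq0 => /eqP.
Qed.

Section diagonals.
Variables (V x y : R * R) (k h : R).
Hypotheses (k0 : 0 < k) (h0 : 0 < h) (xy0 : cross x y != 0).

Let A := V + x.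
Let B := V + y.
Let C := V - k *: x.
Let D := V - h *: y.

Let M m := V + (1 - m) *: x + m *: y.
Let N n := V - ((1 - n) * k) *: x - (n * h) *: y.

Let coordsE (P : R * R) (X Y X' Y' : R) :
  P = V + X *: x + Y *: y -> P = V + X' *: x + Y' *: y -> X = X' /\ Y = Y'.
Proof.
move=> -> E; apply: (cross_coord_inj xy0).
by apply: (addrI V); rewrite !addrA.
Qed.

(** The missing part of the quadrilateral is the triangle [DAV], where the first
   coordinate is positive and the second one negative. *)
Let pentagonP X Y : pentagon A B C D V (V + X *: x + Y *: y) ->
  0 < X -> 0 <= Y.
Proof.
move=> [[|]|] [a [b [c [a0 b0 c0 abc /esym E]]]] X0.
- have [_ <-//] : a = X /\ b = Y.
  apply: (coordsE (P := a *: A + b *: B + c *: V)) => //.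
  rewrite -[V in RHS]scale1r -abc /A /B !scalerDr !scalerDl.
  by apply: pair_ext; rewrite /= /GRing.scale/=; ring.
- have [] : - (b * k) = X /\ a = Y.
    apply: (coordsE (P := a *: B + b *: C + c *: V)) => //.
    rewrite -[V in RHS]scale1r -abc /B /C.
    by apply: pair_ext; rewrite /= /GRing.scale/=; ring.
  by move=> XE _; have := mulr_ge0 b0 (ltW k0); lra.
- have [] : - (a * k) = X /\ - (b * h) = Y.
    apply: (coordsE (P := a *: C + b *: D + c *: V)) => //.
    rewrite -[V in RHS]scale1r -abc /C /D.
    by apply: pair_ext; rewrite /= /GRing.scale/=; ring.
  by move=> XE _; have := mulr_ge0 a0 (ltW k0); lra.
Qed.

(** Both conditions say that the chord does not enter the triangle [DAV]. The point
    of the chord with parameter [t] has a positive first coordinate when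
    [t / (1 - t) < (1 - m) / ((1 - n) k)] and a negative second one when
    [m / (n h) < t / (1 - t)]. *)
Lemma chord_in_pentagonP m n : 0 <= m <= 1 -> 0 <= n <= 1 ->
  segment (M m) (N n) `<=` pentagon A B C D V <->
  n * (1 - m) * h <= m * k * (1 - n).
Proof.
move=> m01 n01.
have zE t : M m + t *: (N n - M m) = V +
    ((1 - t) * (1 - m) - t * ((1 - n) * k)) *: x + ((1 - t) * m - t * (n * h)) *: y.
  by apply: pair_ext; rewrite /M /N /= /GRing.scale/=; ring.
split=> [sub|cond].
  rewrite leNgt; apply/negP => lt.
  pose q := (1 - n) * k; pose p := n * h.
  have q0 : 0 <= q by rewrite mulr_ge0 ?(ltW k0)//; lra.
  have p0 : 0 <= p by rewrite mulr_ge0 ?(ltW h0)//; lra.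
  have qp : 0 < 1 + q + p by lra.
  (* [t / (1 - t)] is the mediant of the two bounds [m / p] and [(1 - m) / q]. *)
  pose t := (1 + q + p)^-1.
  have t0 : 0 < t by rewrite invr_gt0.
  have t1 : t <= 1 by rewrite invf_le1//; lra.
  have t1E : 1 - t = (q + p) * t by rewrite /t; field; rewrite gt_eqF.
  have /sub : segment (M m) (N n) (M m + t *: (N n - M m)).
    by exists t => //; rewrite ltW.
  have mq : m * q < p * (1 - m).
    by move: lt; rewrite /q /p; lra.
  rewrite zE => /pentagonP; rewrite -/q -/p t1E.
  have -> : (q + p) * t * (1 - m) - t * q = t * (p * (1 - m) - m * q) by ring.
  have -> : (q + p) * t * m - t * p = - (t * (p * (1 - m) - m * q)) by ring.
  have d0 : 0 < t * (p * (1 - m) - m * q) by rewrite mulr_gt0// subr_gt0.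
  by move=> /(_ d0); lra.
move=> _ [t t01 ->]; rewrite zE.
set X := (X in X *: x); set Y := (Y in _ + Y *: y).
have k1 : k * k^-1 = 1 by rewrite mulfV// gt_eqF.
have h1 : h * h^-1 = 1 by rewrite mulfV// gt_eqF.
have tn : 0 <= t * n by rewrite mulr_ge0//; lra.
have tn' : 0 <= t * (1 - n) by rewrite mulr_ge0//; lra.
have tm : 0 <= (1 - t) * m by rewrite mulr_ge0//; lra.
have tm' : 0 <= (1 - t) * (1 - m) by rewrite mulr_ge0//; lra.
have Xk : - X / k <= t * (1 - n).
  by rewrite ler_pdivrMr// /X; lra.
have Yh : - Y / h <= t * n.
  by rewrite ler_pdivrMr// /Y; lra.
have X1 : X <= (1 - t) * (1 - m).
  by rewrite /X; have := mulr_ge0 tn' (ltW k0); lra.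
have Y1 : Y <= (1 - t) * m.
  by rewrite /Y; have := mulr_ge0 tn (ltW h0); lra.
have Xk0 : X <= 0 -> 0 <= - X / k by move=> ?; rewrite divr_ge0 ?(ltW k0) ?(ltW h0)//; lra.
have Yh0 : Y <= 0 -> 0 <= - Y / h by move=> ?; rewrite divr_ge0 ?(ltW k0) ?(ltW h0)//; lra.
have [X0|X0] := ltrP 0 X.
  have Y0 : 0 <= Y.
    have m1 : 0 < 1 - m.
      rewrite lt_neqAle; apply/andP; split; last by lra.
      apply/eqP => m1; move: X0; rewrite /X -m1 mulr0 sub0r oppr_gt0 mulrA.
      by have := mulr_ge0 tn' (ltW k0); lra.
    have n1 : 0 < 1 - n.
      rewrite lt_neqAle; apply/andP; split; last by lra.
      apply/eqP => n1; move: cond; rewrite -n1 mulr0 (_ : n = 1) ?mul1r; last by lra.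
      by have := mulr_gt0 m1 h0; lra.
    rewrite -(pmulr_rge0 _ n1) -(pmulr_rge0 _ k0).
    have e1 : 0 <= (1 - t) * (m * k * (1 - n) - n * (1 - m) * h).
      by rewrite mulr_ge0//; lra.
    have e2 : 0 <= n * h * X.
      by rewrite mulr_ge0 ?(ltW X0)// mulr_ge0 ?(ltW h0)//; lra.
    rewrite (_ : k * _ = (1 - t) * (m * k * (1 - n) - n * (1 - m) * h) + n * h * X).
      by rewrite addr_ge0.
    by rewrite /X /Y; ring.
  left; left; exists X, Y, (1 - X - Y); split => //; [exact: ltW|lra|ring|].
  by apply: pair_ext; rewrite /A /B /= /GRing.scale/=; ring.
have [Y0|Y0] := lerP 0 Y.
  left; right; exists Y, (- X / k), (1 - Y - - X / k); split => //; [exact: Xk0|lra|ring|].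
  by apply: pair_ext; rewrite /B /C /= /GRing.scale/=; field; rewrite gt_eqF.
right; exists (- X / k), (- Y / h), (1 - - X / k - - Y / h).
split => //; [exact: Xk0|exact/Yh0/ltW|lra|ring|].
by apply: pair_ext; rewrite /C /D /= /GRing.scale/=; field; rewrite !gt_eqF.
Qed.

(** The line [MN] passes through [V] when both coordinates of a point of the chord
    vanish for the same parameter; eliminate this parameter. *)
Lemma opposite_pointP m n t : 0 <= m <= 1 -> 0 <= n <= 1 ->
  V = M m + t *: (N n - M m) -> n * (m * k + (1 - m) * h) = m * k.
Proof.
move=> m01 n01 E.
have [] : 0 = (1 - t) * (1 - m) - t * ((1 - n) * k) /\ 0 = (1 - t) * m - t * (n * h).
  apply: (coordsE (P := V)); first by rewrite !scale0r !addr0.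
  by rewrite [LHS]E; apply: pair_ext; rewrite /M /N /= /GRing.scale/=; ring.
move=> e1 e2; have t0 : t != 0 by apply/eqP => t0; move: e1 e2; rewrite t0; lra.
apply: (mulfI t0).
apply/eqP; rewrite -subr_eq0; apply/eqP.
transitivity (m * ((1 - t) * (1 - m) - t * ((1 - n) * k)) -
  (1 - m) * ((1 - t) * m - t * (n * h))); first by ring.
by rewrite -e1 -e2; ring.
Qed.

End diagonals.

End plane_geometry.

Section pentagon_frame.
Context {R : realType}.
Implicit Types (A B C D V M N x y u w : R * R) (k h m n s r : R).

Lemma eucl_dist_gt0 A B : A <> B -> 0 < eucl_dist A B.
Proof.
move=> AB; rewrite sqrtr_gt0 lt_neqAle addr_ge0 ?sqr_ge0// andbT eq_sym.
apply/eqP => /eqP; rewrite paddr_eq0 ?sqr_ge0// !sqrf_eq0 !subr_eq0.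
by move=> /andP[/eqP e1 /eqP e2]; apply: AB; exact: pair_ext.
Qed.

Lemma eucl_dist_unit A B u : A <> B -> u = (eucl_dist A B)^-1 *: (B - A) ->
  u.1 ^+ 2 + u.2 ^+ 2 = 1.
Proof.
move=> /eucl_dist_gt0 L0 ->; rewrite /= /GRing.scale/= !exprMn -mulrDr.
rewrite -[X in _ * X]sqr_sqrtr ?addr_ge0 ?sqr_ge0//.
by rewrite -/(eucl_dist A B) -exprMn mulVf ?expr1n// gt_eqF.
Qed.

Lemma segmentP A B u M : A <> B -> u = (eucl_dist A B)^-1 *: (B - A) ->
  segment A B M <-> exists2 s, 0 <= s <= eucl_dist A B & M = A + s *: u.
Proof.
move=> /eucl_dist_gt0 L0 ->; set L := eucl_dist A B in L0 *; split.
  move=> [t /andP[t0 t1] ->]; exists (t * L).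
    by rewrite mulr_ge0 ?(ltW L0)//= ler_piMl// ltW.
  by rewrite scalerA mulfK// gt_eqF.
move=> [s /andP[s0 sL] ->]; exists (s / L).
  by rewrite divr_ge0 ?(ltW L0)//= ler_pdivrMr// mul1r.
by rewrite scalerA.
Qed.

Lemma segment_ray A u s s' M : 0 < s' -> 0 <= s ->
  segment (A + s *: u) (A + (s + s') *: u) M <->
  exists2 t, s <= t <= s + s' & M = A + t *: u.
Proof.
move=> s'0 s0; split.
  move=> [t /andP[t0 t1] ->]; exists (s + t * s').
    by rewrite lerDl mulr_ge0 ?(ltW s'0)//= lerD2l ler_piMl// ltW.
  by apply: pair_ext; rewrite /= /GRing.scale/=; ring.
move=> [t /andP[t0 t1] ->]; exists ((t - s) / s').
  by rewrite divr_ge0 ?subr_ge0 ?(ltW s'0)//= ler_pdivrMr// mul1r lerBlDl.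
by apply: pair_ext; rewrite /= /GRing.scale/=; field; rewrite gt_eqF.
Qed.

Variables (A B C D V u w : R * R) (op : R * R -> R * R).
Hypotheses (hABCD : convex_quadrilateral A B C D)
  (hVAC : segment A C V) (hVBD : segment B D V)
  (hop : forall M : R * R, segment A B M ->
             segment C D (op M) /\ line_through M (op M) V).

(** The corners of a convex quadrilateral are not degenerate, which prevents [V]
    from being one of the vertices. *)
Lemma diagonal_frame : exists x y k h,
  [/\ 0 < k, 0 < h, cross x y != 0, A = V + x & [/\ B = V + y,
      C = V - k *: x & D = V - h *: y]].
Proof.
have [t /andP[t0 t1] VA] := hVAC; have [s /andP[s0 s1] VB] := hVBD.
case: hABCD; rewrite /same_side => h1 h2 h3 h4.
have nz a b : 0 < a * b :> R -> a != 0 by apply: contraL => /eqP ->; rewrite mul0r ltxx.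
have {}h1 := nz _ _ h1; have {}h2 := nz _ _ h2.
have {}h3 := nz _ _ h3; have {}h4 := nz _ _ h4.
have tn0 : t != 0.
  apply: contra h4 => /eqP t00; apply/eqP; move: VA VB; rewrite t00 scale0r addr0 => -> AE.
  have e1 := congr1 fst AE; have e2 := congr1 snd AE; move: e1 e2.
  rewrite /cross /= /GRing.scale/= => e1 e2.
  transitivity ((A.1 - B.1 - s * (D.1 - B.1)) * (B.2 - D.2)
    - (A.2 - B.2 - s * (D.2 - B.2)) * (B.1 - D.1)); first by ring.
  by rewrite e1 e2; ring.
have tn1 : t != 1.
  apply: contra h2 => /eqP t11; apply/eqP; move: VA VB.
  rewrite t11 scale1r addrC subrK => -> CE.
  have e1 := congr1 fst CE; have e2 := congr1 snd CE; move: e1 e2.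
  rewrite /cross /= /GRing.scale/= => e1 e2.
  transitivity ((C.1 - B.1 - s * (D.1 - B.1)) * (D.2 - B.2)
    - (C.2 - B.2 - s * (D.2 - B.2)) * (D.1 - B.1)); first by ring.
  by rewrite e1 e2; ring.
have sn0 : s != 0.
  apply: contra h1 => /eqP s00; apply/eqP; move: VB VA; rewrite s00 scale0r addr0 => -> BE.
  have e1 := congr1 fst BE; have e2 := congr1 snd BE; move: e1 e2.
  rewrite /cross /= /GRing.scale/= => e1 e2.
  transitivity ((B.1 - A.1 - t * (C.1 - A.1)) * (C.2 - A.2)
    - (B.2 - A.2 - t * (C.2 - A.2)) * (C.1 - A.1)); first by ring.
  by rewrite e1 e2; ring.
have sn1 : s != 1.
  apply: contra h3 => /eqP s11; apply/eqP; move: VB VA.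
  rewrite s11 scale1r addrC subrK => -> DE.
  have e1 := congr1 fst DE; have e2 := congr1 snd DE; move: e1 e2.
  rewrite /cross /= /GRing.scale/= => e1 e2.
  transitivity ((D.1 - A.1 - t * (C.1 - A.1)) * (A.2 - C.2)
    - (D.2 - A.2 - t * (C.2 - A.2)) * (A.1 - C.1)); first by ring.
  by rewrite e1 e2; ring.
have tp : 0 < t by rewrite lt_neqAle eq_sym tn0.
have sp : 0 < s by rewrite lt_neqAle eq_sym sn0.
have tq : 0 < 1 - t by rewrite subr_gt0 lt_neqAle tn1.
have sq : 0 < 1 - s by rewrite subr_gt0 lt_neqAle sn1.
exists (A - V), (B - V), ((1 - t) / t), ((1 - s) / s).
split; rewrite ?divr_gt0// ?(addrC V) ?subrK//.
  have -> : cross (A - V) (B - V) = t * cross (B - A) (C - A).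
    by rewrite VA /cross /= /GRing.scale/=; ring.
  by rewrite mulf_neq0.
split=> //.
  by rewrite {2}VA VA; apply: pair_ext; rewrite /= /GRing.scale/=; field.
by rewrite {2}VB VB; apply: pair_ext; rewrite /= /GRing.scale/=; field.
Qed.

Hypothesis hu : u = (eucl_dist A B)^-1 *: (B - A).
Hypothesis hw : w = (eucl_dist C D)^-1 *: (D - C).

Let La := eucl_dist A B.
Let Lb := eucl_dist C D.

(** All that the rest of the proof uses of the quadrilateral, in the abscissas [s]
    and [r]: both lines are seen transversally from the opposite segment, and
    [opp s] is the abscissa of the point opposite to [A + s *: u]. The sign [e] is
    the orientation of the quadrilateral. *)
Lemma pentagon_frame : A <> B /\ C <> D /\ exists k h : R, exists e : bool,
  let opp a := Lb * ((a * k) / (a * k + (La - a) * h)) in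
  [/\ 0 < k, 0 < h,
      forall s r, 0 <= r <= Lb -> cross (chord_vec A u C w s r) u != 0,
      forall s, 0 <= s <= La -> 0 < (-1) ^+ e * height A u C w s &
      (forall a, 0 <= a <= La -> op (A + a *: u) = C + opp a *: w) /\
      (forall s r, 0 <= s <= La -> 0 <= r <= Lb ->
        segment (A + s *: u) (C + r *: w) `<=` pentagon A B C D V <-> r <= opp s)].
Proof.
have [x [y [k [h [k0 h0 xy0 AE [BE CE DE]]]]]] := diagonal_frame.
have xyne : forall X Y : R, X *: x + Y *: y = 0 -> X = 0 /\ Y = 0.
  by move=> X Y E; apply: (cross_coord_inj xy0); rewrite E !scale0r addr0.
have AB : A <> B.
  move=> E; have [] : (1 : R) = 0 /\ (- 1 : R) = 0.
    apply: xyne; move: E; rewrite AE BE => /addrI ->.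
    by rewrite scale1r scaleN1r subrr.
  by move=> /eqP; rewrite oner_eq0.
have CD : C <> D.
  move=> E; have [] : k = 0 /\ - h = 0 :> R.
    apply: xyne; move: E; rewrite CE DE => /addrI/oppr_inj ->.
    by rewrite scaleNr subrr.
  by move=> k00; move: k0; rewrite k00 ltxx.
have La0 : 0 < La by exact: eucl_dist_gt0.
have Lb0 : 0 < Lb by exact: eucl_dist_gt0.
split=> //; split=> //.
exists k, h, (cross x y < 0); move=> opp.
have uE : u = La^-1 *: (y - x) by rewrite hu -/La {1}AE BE opprD addrACA subrr add0r.
have wE : w = Lb^-1 *: (k *: x - h *: y).
  by rewrite hw -/Lb {1}CE DE opprD addrACA subrr add0r opprK addrC.
have ME s : A + s *: u = V + (1 - s / La) *: x + (s / La) *: y.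
  by rewrite AE uE; apply: pair_ext; rewrite /= /GRing.scale/=; ring.
have NE r : C + r *: w = V - ((1 - r / Lb) * k) *: x - (r / Lb * h) *: y.
  by rewrite CE wE; apply: pair_ext; rewrite /= /GRing.scale/=; ring.
have den a : 0 <= a <= La -> 0 < a * k + (La - a) * h.
  move=> /andP[a0 aL]; move: a0; rewrite le_eqVlt => /predU1P[<-|a0].
    by rewrite mul0r add0r subr0 mulr_gt0.
  by rewrite ltr_pwDl ?mulr_gt0// mulr_ge0 ?subr_ge0// ltW.
have ratio (L a : R) : 0 < L -> 0 <= a <= L -> 0 <= a / L <= 1.
  by move=> L0 /andP[a0 aL]; rewrite divr_ge0 ?(ltW L0)//= ler_pdivrMr// mul1r.
split=> //.
- move=> s r /(ratio _ _ Lb0); set n := r / Lb => n01.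
  have -> : cross (chord_vec A u C w s r) u =
      - La^-1 * cross x y * (1 + (1 - n) * k + n * h).
    rewrite /chord_vec NE -/n AE uE /cross /= /GRing.scale/=; ring.
  have p1 : 0 <= (1 - n) * k by rewrite mulr_ge0 ?(ltW k0)//; lra.
  have p2 : 0 <= n * h by rewrite mulr_ge0 ?(ltW h0)//; lra.
  have p3 : 1 + (1 - n) * k + n * h != 0 by rewrite gt_eqF//; lra.
  by rewrite !mulf_neq0// oppr_eq0 invr_eq0 gt_eqF.
- move=> s /(ratio _ _ La0); set m := s / La => m01.
  have -> : height A u C w s = Lb^-1 * cross x y * ((k + 1 - m) * h + m * k).
    rewrite /height /chord_vec scale0r addr0 ME -/m CE wE /cross /= /GRing.scale/=.
    by ring.
  have c0 : 0 < (-1) ^+ (cross x y < 0)%R * cross x y.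
    by move: xy0; case: (ltgtP (cross x y) 0) => // c0 _;
      [rewrite expr1 mulN1r oppr_gt0|rewrite expr0 mul1r].
  have p1 : 0 < k * h by exact: mulr_gt0.
  have p2 : 0 <= (1 - m) * h by rewrite mulr_ge0 ?(ltW h0)//; lra.
  have p3 : 0 <= m * k by rewrite mulr_ge0 ?(ltW k0)//; lra.
  have p4 : 0 < (k + 1 - m) * h + m * k by lra.
  move: c0; set sg := (-1) ^+ _ => c0.
  rewrite [X in 0 < X](_ : _ = Lb^-1 * (sg * cross x y) * ((k + 1 - m) * h + m * k)).
    by rewrite mulr_gt0// mulr_gt0// invr_gt0.
  by ring.
split.
- move=> a aL.
  have sM : segment A B (A + a *: u) by apply/(segmentP _ AB hu); exists a.
  have [/(segmentP _ CD hw)[r rL opE] [t Vt]] := hop sM.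
  rewrite opE; congr (C + _ *: w).
  have := @opposite_pointP R V x y k h xy0 (a / La) (r / Lb) t
    (ratio _ _ La0 aL) (ratio _ _ Lb0 rL).
  rewrite -ME -NE -opE => /(_ Vt) E.
  have d0 := den _ aL; rewrite /opp.
  have Lan : La != 0 by rewrite gt_eqF.
  have Lbn : Lb != 0 by rewrite gt_eqF.
  apply: (mulfI (invr_neq0 Lbn)); rewrite [RHS]mulKf// [LHS]mulrC.
  apply: (mulIf (lt0r_neq0 d0)); rewrite divfK ?gt_eqF//.
  transitivity (La * (r / Lb * (a / La * k + (1 - a / La) * h))).
    by field; rewrite Lan Lbn.
  by rewrite E; field.
move=> s r sL rL.
have := chord_in_pentagonP V k0 h0 xy0 (ratio _ _ La0 sL) (ratio _ _ Lb0 rL).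
rewrite -AE -BE -CE -DE -ME -NE => ->.
have d0 := den _ sL; rewrite /opp.
have -> : (r <= Lb * (s * k / (s * k + (La - s) * h))) =
    (r / Lb * (s / La * k + (1 - s / La) * h) <= s / La * k).
  rewrite -ler_pdivrMl// mulrC ler_pdivlMr// -(ler_pM2l (x := La^-1)) ?invr_gt0//.
  by congr (_ <= _); field; rewrite !gt_eqF.
by split=> ?; lra.
Qed.

End pentagon_frame.

(** * Exceptional lengths and abscissas *)

Section exceptional_values.
Context {R : realType}.
Notation mu := (@lebesgue_measure R).

Lemma finite_poly_roots (p : {poly R}) : p != 0 -> finite_set [set x | p.[x] = 0].
Proof.
move=> p0; apply: contrapT => /(infinite_set_fset (size p))[B BS sB].
have : (size (finmap.enum_fset B) < size p)%N.
  apply: max_poly_roots => //; last exact: finmap.fset_uniq.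
  by apply/allP => x xB; apply/rootP; exact: BS.
by rewrite ltnNge sB.
Qed.

(** If [p = l^2 q] held identically for two positive values of [l], then [q] would
    be zero. *)
Lemma ae_finite_poly_level (p q : {poly R}) : q != 0 ->
  {ae mu, forall l, 0 < l -> finite_set [set x | p.[x] = l ^+ 2 * q.[x]]}.
Proof.
move=> q0.
have fin l : p - (l ^+ 2) *: q != 0 -> finite_set [set x | p.[x] = l ^+ 2 * q.[x]].
  move=> /finite_poly_roots; apply: sub_finite_set => x /= px.
  by rewrite hornerD hornerN hornerZ px subrr.
have [[l0 [l00 pl0]]|nl] := pselect (exists l0, 0 < l0 /\ p = (l0 ^+ 2) *: q).
  exists [set l0]; split; [exact: measurable_set1|exact: lebesgue_measure_set1|].
  move=> l /= h; apply: contrapT => ll0; apply: h => l_gt0; apply: fin.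
  rewrite pl0 -scalerBl scaler_eq0 (negbTE q0) orbF subr_eq0.
  by apply: contra_notN ll0; rewrite eqrXn2 ?ltW// => /eqP.
apply: aeW => l l0; apply: fin; apply/eqP => /eqP; rewrite subr_eq0 => /eqP pl.
by apply: nl; exists l.
Qed.

(** Borel measurability is not preserved by changes on null sets, but it is by
    changes at finitely many points. *)
Lemma measurable_fun_off_finite (D F : set R) (f g : R -> R) :
  measurable D -> finite_set F -> measurable_fun D g ->
  (forall x, D x -> ~ F x -> f x = g x) -> measurable_fun D f.
Proof.
move=> mD finF mg fg mD' Y mY.
have cF : countable F by exact: finite_set_countable.
have mF : measurable F by exact: countable_measurable.
have -> : D `&` f @^-1` Y = ((D `&` g @^-1` Y) `\` F) `|` (D `&` f @^-1` Y `&` F).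
  apply/seteqP; split => x.
    move=> [Dx fY]; have [Fx|Fx] := pselect (F x); first by right.
    by left; split => //; split => //=; rewrite -fg.
  by move=> [[[Dx gY] Fx]|[[Dx fY] _]]; split => //=; rewrite fg.
apply: measurableU; first by apply: measurableD => //; exact: mg.
have cDF : countable (D `&` f @^-1` Y `&` F).
  by apply: finite_set_countable; apply: sub_finite_set finF => x [].
exact: countable_measurable.
Qed.

End exceptional_values.

(** * The densities of the chords between segments *)

Section densities_of_chords.
Context {R : realType}.
Notation mu := (@lebesgue_measure R).
Variables (A u C w : R * R) (La Lb : R) (e : bool).
Hypothesis unit_u : u.1 ^+ 2 + u.2 ^+ 2 = 1.
Hypothesis unit_w : w.1 ^+ 2 + w.2 ^+ 2 = 1.
Hypothesis transversal : forall s r, 0 <= r <= Lb ->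
  cross (chord_vec A u C w s r) u != 0.
Hypothesis height_sign : forall s, 0 <= s <= La ->
  0 < (-1) ^+ e * height A u C w s.

Notation height := (height A u C w).
Notation kernel b := (chord_kernel A u C w (strip b)).

Lemma chord_kernel_section (T T' : set (R * R)) s l :
  (forall r, T (s, r) <-> T' (s, r)) ->
  chord_kernel A u C w T s l = chord_kernel A u C w T' s l.
Proof.
move=> TT'; rewrite /chord_kernel /branch_kernel !indicE.
have mE r : ((s, r) \in T) = ((s, r) \in T').
  by apply/idP/idP => /set_mem/TT'/mem_set.
by rewrite !mE.
Qed.

Lemma chord_kernel_empty_section (T : set (R * R)) s l :
  (forall r, ~ T (s, r)) -> chord_kernel A u C w T s l = 0.
Proof.
by move=> nT; rewrite /chord_kernel /branch_kernel !indicE !memNset// !mul0r addr0.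
Qed.

Definition below_graph (a1 a2 : R) (b : R -> R) : set (R * R) :=
  [set z | a1 <= z.1 <= a2 /\ 0 <= z.2 <= b z.1].

Section moving_bound.
Variables (a1 a2 : R) (b : R -> R).
Hypotheses (a10 : 0 <= a1) (a2L : a2 <= La) (mb : measurable_fun setT b).
Hypothesis b_bound : forall s, a1 <= s <= a2 -> 0 <= b s <= Lb.

Let J : set R := `[a1, a2]%classic.
Let mJ : measurable J. Proof. exact: measurable_itv. Qed.

Definition length_integral (l : R) : R := \int[mu]_(s in `[a1, a2]) kernel (b s) s l.

Let region : set (R * R) := [set z | 0 <= z.2 <= b z.1].

Let measurable_region : measurable region.
Proof.
have m1 : measurable_fun setT (fun z : R * R => z.1) by exact: measurable_fst.
have m2 : measurable_fun setT (fun z : R * R => z.2) by exact: measurable_snd.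
rewrite (_ : region = (snd @^-1` `[0, +oo[) `&`
  ((fun z => b z.1 - z.2) @^-1` `[0, +oo[)).
  apply: measurableI; first exact: measurable_preimageT.
  by apply: measurable_preimageT => //; apply: measurable_funB => //;
    exact: measurableT_comp.
apply/seteqP; split=> -[s r]; rewrite /region/= !in_itv/= !andbT subr_ge0.
  by move=> /andP[].
by move=> [-> ->].
Qed.

Let mU : measurable (below_graph a1 a2 b).
Proof.
rewrite (_ : below_graph a1 a2 b = (fst @^-1` J) `&` region).
  by apply: measurableI => //; apply: measurable_preimageT => //; exact: measurable_fst.
by apply/seteqP; split=> -[s r]; rewrite /below_graph /region/= /J/= in_itv/= => -[].
Qed.

Lemma measurable_moving_kernel l : measurable_fun setT (fun s => kernel (b s) s l).
Proof.
have mk := measurable_chord_kernel A u C w measurable_region.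
have := measurableT_comp mk (measurable_pair2 l).
apply: eq_measurable_fun => s _ /=.
exact: chord_kernel_section.
Qed.

Lemma chord_kernel_below_graph s l :
  (chord_kernel A u C w (below_graph a1 a2 b) s l)%:E =
  ((fun s => (kernel (b s) s l)%:E) \_ J) s.
Proof.
rewrite patchE; case: ifPn => sJ.
  congr (_%:E); apply: chord_kernel_section => r; rewrite /below_graph /strip/=.
  by move: sJ; rewrite inE /J/= in_itv/= => ->; split=> [[]|].
rewrite chord_kernel_empty_section// => r [/= sJ' _].
by move/negP: sJ; apply; rewrite inE /J/= in_itv.
Qed.

(** The kernel grows with the segment, so it is dominated by that of the whole
    segment of length [Lb]. *)
Lemma integrable_moving_kernel l : 0 < l ->
  mu.-integrable J (fun s => (kernel (b s) s l)%:E).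
Proof.
move=> l0; have [J0|/set0P[s1 s1J]] := eqVneq J set0.
  by rewrite J0; exact: integrable_set0.
have Lb0 : 0 <= Lb.
  move: s1J; rewrite /J/= in_itv/= => /b_bound/andP[]; exact: le_trans.
have hs s : a1 <= s <= a2 -> 0 < (-1) ^+ e * height s.
  move=> /andP[s1' s2']; apply: height_sign.
  by rewrite (le_trans a10 s1') (le_trans s2' a2L).
have ik := integrable_kernel hs Lb0 l0.
apply: (@le_integrable _ (measurableTypeR R) R mu J mJ _ _ _ _ ik).
  by apply/measurable_EFinP; apply: measurable_funTS; exact: measurable_moving_kernel.
move=> s; rewrite /J/= in_itv/= => /b_bound/andP[_ bL].
rewrite lee_fin !ger0_norm ?chord_kernel_ge0//.
apply: lerD; rewrite /branch_kernel ler_wpM2r//.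
- by rewrite divr_ge0// mulr_ge0 ?sqr_ge0 ?sqrtr_ge0.
- rewrite !indicE ler_nat; case: (boolP (_ \in strip (b s))) => [/set_mem|]//.
  by rewrite /strip/= => /andP[? ?]; rewrite mem_set//= /strip/=; lra.
- by rewrite divr_ge0// mulr_ge0 ?sqr_ge0 ?sqrtr_ge0.
- rewrite !indicE ler_nat; case: (boolP (_ \in strip (b s))) => [/set_mem|]//.
  by rewrite /strip/= => /andP[? ?]; rewrite mem_set//= /strip/=; lra.
Qed.

Lemma length_integralE l : 0 < l -> ((length_integral l)%:E =
  \int[mu]_s (chord_kernel A u C w (below_graph a1 a2 b) s l)%:E)%E.
Proof.
move=> l0; under [RHS]eq_integral do rewrite chord_kernel_below_graph.
rewrite -integral_mkcond fineK//.
by apply: integrable_fin_num => //; exact: integrable_moving_kernel.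
Qed.

Lemma length_integral_ge0 l : 0 <= length_integral l.
Proof. by apply: Rintegral_ge0 => s _; exact: chord_kernel_ge0. Qed.

Lemma length_density_below_graph (L : set R -> set (R * R)) :
  (forall E, L E = lines_joining A u C w (below_graph a1 a2 b) E) ->
  length_density L length_integral.
Proof.
move=> LE; split.
  have mk := measurable_chord_kernel A u C w mU.
  have mG : measurable_fun setT
      (fun l => \int[mu]_s (chord_kernel A u C w (below_graph a1 a2 b) s l)%:E)%E.
    apply: (@measurable_fun_fubini_tonelli_G _ _ (measurableTypeR R)
      (measurableTypeR R) R mu (fun z => (chord_kernel A u C w (below_graph a1 a2 b) z.1 z.2)%:E)).
    - exact/measurable_EFinP.
    - by move=> z; rewrite lee_fin chord_kernel_ge0.
  have mc : measurable_fun (`]0, +oo[ : set R) (fun l =>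
      fine (\int[mu]_s (chord_kernel A u C w (below_graph a1 a2 b) s l)%:E)).
    apply: measurable_funTS.
    exact: (measurableT_comp (fine_measurable measurableT) mG).
  apply: eq_measurable_fun mc => l.
  by rewrite inE/= in_itv/= andbT => l0; rewrite -length_integralE.
move=> E mE E0; rewrite LE line_measure_kernel//; last first.
  move=> s r [/= sa /andP[r0 rb]]; have /andP[_ bL] := b_bound sa.
  split; first by apply: transversal; rewrite r0 (le_trans rb).
  rewrite height_const; apply/eqP => h0.
  have sL : 0 <= s <= La.
    by move: sa => /andP[s1 s2]; rewrite (le_trans a10 s1) (le_trans s2 a2L).
  by have := height_sign sL; rewrite h0 mulr0 ltxx.
apply: eq_integral => l /[!inE] /E0; rewrite /= in_itv/= andbT => l0.
exact: length_integralE.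
Qed.

End moving_bound.

(** The integral of the kernel is a density which is continuous wherever [rho] has
    to be, and these two properties determine [rho]. *)
Lemma rhoE (a t b l : R) : 0 <= a -> 0 < t -> a + t <= La -> 0 < b <= Lb -> 0 < l ->
  (cross u w = 0 -> `|height 0| != l) ->
  rho (A + a *: u) (A + a *: u + t *: u) C (C + b *: w) l =
  \int[mu]_(s in `[a, a + t]) kernel b s l.
Proof.
move=> a0 t0 atL /andP[b0 bL] l0 hl.
have unit_neq0 (v : R * R) : v.1 ^+ 2 + v.2 ^+ 2 = 1 -> v != 0.
  move=> v1; apply/eqP => v0; move: v1; rewrite v0 /= expr0n addr0 => /esym/eqP.
  by rewrite oner_eq0.
have neq (P v : R * R) (c : R) : 0 < c -> v.1 ^+ 2 + v.2 ^+ 2 = 1 ->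
    (P == P + c *: v) = false.
  move=> c0 /unit_neq0 v0; apply/negbTE; rewrite -[X in X == _]addr0 (inj_eq (addrI _)).
  by rewrite eq_sym scaler_eq0 negb_or gt_eqF.
rewrite /rho !neq//=.
set L := chords _ _ _ _.
pose F := length_integral a (a + t) (fun=> b).
have bb s : a <= s <= a + t -> 0 <= b <= Lb by move=> _; rewrite bL ltW.
have hs s : a <= s <= a + t -> 0 < (-1) ^+ e * height s.
  by move=> sa; apply: height_sign; lra.
have LE E : L E = lines_joining A u C w (below_graph a (a + t) (fun=> b)) E.
  have PE : A + a *: u + t *: u = A + (a + t) *: u by rewrite scalerDl addrA.
  have C0 : C = C + 0 *: w by rewrite scale0r addr0.
  have CE : C + b *: w = C + (0 + b) *: w by rewrite add0r.
  apply/seteqP; split=> k.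
    move=> [M [N [[]]]]; rewrite PE => /(segment_ray _ _ _ t0 a0)[s sa ->].
    rewrite CE [X in segment X]C0 => /(segment_ray _ _ _ b0 (lexx 0))[r rb ->] lM lN EMN.
    by exists s, r; split => //; split => //=; rewrite add0r in rb.
  move=> [s [r [[/= sa rb] lM lN EMN]]].
  exists (A + s *: u), (C + r *: w); split => //; split => //.
    by rewrite PE; apply/(segment_ray _ _ _ t0 a0); exists s.
  rewrite CE [X in segment X]C0; apply/(segment_ray _ _ _ b0 (lexx 0)); exists r => //.
  by rewrite add0r.
have dF : length_density L F.
  by apply: length_density_below_graph => //; exact: measurable_cst.
have cF k : 0 < k -> (cross u w = 0 -> `|height 0| != k) -> {for k, continuous F}.
  by move=> k0 hk; exact: (continuous_chord_integral unit_u unit_w hs (ltW b0) k0 hk).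
have par : parallel (A + a *: u) (A + a *: u + t *: u) C (C + b *: w) <-> cross u w = 0.
  have E : cross (A + a *: u + t *: u - (A + a *: u)) (C + b *: w - C) = t * b * cross u w.
    by rewrite /cross /= /GRing.scale/=; ring.
  rewrite /parallel E; split => [/eqP|->]; last by rewrite mulr0.
  by rewrite !mulf_eq0 (gt_eqF t0) (gt_eqF b0) => /eqP.
(* Parallel unit vectors are equal or opposite, hence the distance of the lines can
   be computed along either of them. *)
have dist : cross u w = 0 ->
    line_dist (A + a *: u) (A + a *: u + t *: u) C = `|height 0|.
  move=> uw0.
  have dE : eucl_dist (A + a *: u) (A + a *: u + t *: u) = t.
    rewrite /eucl_dist (_ : _ + _ = t ^+ 2 * (u.1 ^+ 2 + u.2 ^+ 2)).
      by rewrite unit_u mulr1 sqrtr_sqr gtr0_norm.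
    by rewrite /= /GRing.scale/=; ring.
  rewrite /line_dist dE.
  rewrite (_ : cross _ _ = t * cross u (C - A)); last first.
    by rewrite /cross /= /GRing.scale/=; ring.
  rewrite normrM (gtr0_norm t0) mulrAC mulfV ?gt_eqF// mul1r.
  pose c := u.1 * w.1 + u.2 * w.2.
  have w1 : w.1 = c * u.1.
    rewrite /c -[LHS]mulr1 -unit_u; apply/eqP; rewrite -subr_eq0; apply/eqP.
    transitivity (- u.2 * cross u w); last by rewrite uw0 mulr0.
    by rewrite /cross; ring.
  have w2 : w.2 = c * u.2.
    rewrite /c -[LHS]mulr1 -unit_u; apply/eqP; rewrite -subr_eq0; apply/eqP.
    transitivity (u.1 * cross u w); last by rewrite uw0 mulr0.
    by rewrite /cross; ring.
  have c2 : `|c| = 1.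
    apply/eqP; rewrite -[_ == _](@eqrXn2 _ 2)// expr1n real_normK ?num_real//.
    by rewrite -unit_w w1 w2 -[X in X == _]mulr1 -unit_u; apply/eqP; ring.
  rewrite (_ : height 0 = - c * cross u (C - A)); last first.
    by rewrite /height /chord_vec /cross w1 w2 /= /GRing.scale/=; ring.
  by rewrite normrM normrN c2 mul1r.
set S := [set f | _].
have SF : S F.
  split => // k k0 hk; apply: cF => // uw0; apply/eqP => hkE.
  by apply: (hk ((par).2 uw0)); rewrite dist.
have [dg cg] : S (xget (cst 0) S) by exact: xgetI SF.
apply: (@eq_at_continuity_point _ (xget (cst 0) S) F l l0).
- apply: cg => // /par uw0 lE; move: (hl uw0); rewrite -(dist uw0) lE eqxx//.
- exact: cF.
- apply: ae_eq_of_integrals.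
  + exact: dg.1.
  + exact: dF.1.
  + by move=> x _; exact: length_integral_ge0.
  + by move=> E mE E0; rewrite dg.2// dF.2.
Qed.

End densities_of_chords.

(** * The integral of the derivative *)

Section exceptional_abscissas.
Context {R : realType}.
Notation mu := (@lebesgue_measure R).

(** The abscissa of the opposite point is a rational function of [s]; multiplying by
    the square of its denominator, which vanishes nowhere on the segment, gives a
    polynomial equation. *)
Lemma ae_finite_opposite_sphere (A u C w : R * R) (La Lb k h : R) :
  w.1 ^+ 2 + w.2 ^+ 2 = 1 -> 0 < La -> 0 < k -> 0 < h ->
  {ae mu, forall l, 0 < l -> finite_set [set s | 0 <= s <= La /\
    chord_length A u C w s (Lb * (s * k / (s * k + (La - s) * h))) ^+ 2 = l ^+ 2]}.
Proof.
move=> unit_w La0 k0 h0.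
pose den : {poly R} := k%:P * 'X + h%:P * (La%:P - 'X).
pose num : {poly R} := (Lb * k)%:P * 'X.
pose ft : {poly R} := (foot A u C w 0)%:P + (u.1 * w.1 + u.2 * w.2)%:P * 'X.
pose ht : {poly R} := (height A u C w 0)%:P + (- cross u w)%:P * 'X.
have poly_evalE := (hornerD, hornerN, hornerM, hornerC, hornerX).
have denE s : den.[s] = s * k + (La - s) * h by rewrite /den !poly_evalE; ring.
have numE s : num.[s] = Lb * (s * k) by rewrite /num !poly_evalE; ring.
have ftE s : ft.[s] = foot A u C w s.
  by rewrite foot_affine /ft !poly_evalE; ring.
have htE s : ht.[s] = height A u C w s.
  by rewrite height_affine /ht !poly_evalE; ring.
have den0 : den ^+ 2 != 0.
  rewrite expf_eq0/=; apply/eqP => den0; have := denE La.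
  rewrite den0 horner0 subrr mul0r addr0 => /esym/eqP.
  by rewrite mulf_eq0 !gt_eqF.
clearbody den num ft ht.
have := ae_finite_poly_level ((num - ft * den) ^+ 2 + (ht * den) ^+ 2) den0.
apply: (@filterS _ _ (ae_filter_ringOfSetsType mu)) => l /= fin l0.
apply: sub_finite_set (fin l0) => s /= [sL].
rewrite chord_length_sq// => sl.
have d0 : s * k + (La - s) * h != 0.
  move: sL => /andP[s0 sL]; rewrite gt_eqF//.
  move: s0; rewrite le_eqVlt => /predU1P[<-|s0].
    by rewrite mul0r add0r subr0 mulr_gt0.
  by rewrite ltr_pwDl ?mulr_gt0// mulr_ge0 ?subr_ge0// ltW.
rewrite !(hornerD, hornerN, hornerM, horner_exp) denE numE ftE htE -sl.
move: (foot A u C w s) (height A u C w s) => x y.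
by field.
Qed.

End exceptional_abscissas.

Theorem proposition9p1 (R : realType) (A B C D V u : R * R)
    (op : R * R -> R * R)
    (hABCD : convex_quadrilateral A B C D)
    (hVAC : segment A C V) (hVBD : segment B D V)
    (hu : u = (eucl_dist A B)^-1 *: (B - A))
    (hop : forall M : R * R, segment A B M ->
             segment C D (op M) /\ line_through M (op M) V) :
  {ae lebesgue_measure, forall l : R, 0 < l ->
    [/\ {ae lebesgue_measure, forall a : R, 0 <= a <= eucl_dist A B ->
           cvg (rho2_quotient u (A + a *: u) C (op (A + a *: u)) l t
                  @[t --> 0^'+])},
        lebesgue_measure.-integrable `[0, eucl_dist A B]
          (fun a : R => (rho2 u (A + a *: u) C (op (A + a *: u)) l)%:E) &
        \int[lebesgue_measure]_(a in (`[0, eucl_dist A B] : set R))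
          rho2 u (A + a *: u) C (op (A + a *: u)) l
        = rho_conc A B C D V l]}.
Proof.
pose mu := @lebesgue_measure R.
pose w := (eucl_dist C D)^-1 *: (D - C).
have [AB [CD [k [h [e /= [k0 h0 tr hs [opE inK]]]]]]] :=
  pentagon_frame hABCD hVAC hVBD hop hu (erefl w).
have unit_u := eucl_dist_unit AB hu.
have unit_w : w.1 ^+ 2 + w.2 ^+ 2 = 1 by exact: (eucl_dist_unit CD).
have La0 : 0 < eucl_dist A B by exact: eucl_dist_gt0.
have Lb0 : 0 < eucl_dist C D by exact: eucl_dist_gt0.
have abP := segmentP _ AB hu; have cdP := segmentP _ CD (erefl w).
have oppS := ae_finite_opposite_sphere A u C (eucl_dist C D) unit_w La0 k0 h0.
move: (eucl_dist A B) (eucl_dist C D) @w unit_w La0 Lb0 abP cdP oppS tr hs opE inK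
  => La Lb w unit_w La0 Lb0 abP cdP oppS tr hs opE inK.
pose opp s := Lb * (s * k / (s * k + (La - s) * h)).
have mopp : measurable_fun setT opp.
  apply: measurable_funM => //; apply: measurable_divr.
    exact: measurable_funM.
  by apply: measurable_funD; apply: measurable_funM => //; exact: measurable_funB.
have opp_bound s : 0 <= s <= La -> 0 <= opp s <= Lb.
  move=> /andP[s0 sL].
  have n0 : 0 <= s * k by rewrite mulr_ge0// ltW.
  have m0 : 0 <= (La - s) * h by rewrite mulr_ge0 ?subr_ge0// ltW.
  rewrite /opp mulr_ge0 ?divr_ge0 ?addr_ge0 ?(ltW Lb0)//= -[leRHS]mulr1.
  rewrite ler_wpM2l ?(ltW Lb0)//.
  have [->|d0] := eqVneq (s * k + (La - s) * h) 0; first by rewrite invr0 mulr0.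
  by rewrite ler_pdivrMr ?mul1r ?lerDl// lt_neqAle eq_sym d0 addr_ge0.
have opp_gt0 s : 0 < s <= La -> 0 < opp s.
  move=> /andP[s0 sL]; rewrite /opp mulr_gt0// divr_gt0 ?mulr_gt0//.
  by rewrite ltr_pwDl ?mulr_gt0// mulr_ge0 ?subr_ge0// ltW.
have conc_density : length_density (chords_in (pentagon A B C D V) A B C D)
    (length_integral A u C w 0 La opp).
  apply: (length_density_below_graph unit_w tr hs (lexx 0) (lexx La) mopp opp_bound) => E.
  apply/seteqP; split=> l.
    move=> [M [N [[/abP[s sL ->] /cdP[r rL ->] lM lN] sub EMN]]].
    exists s, r; split => //; split => //=.
    by move/inK : sub => /(_ sL rL) ->; move: rL => /andP[->].
  move=> [s [r [[/= sL /andP[r0 rs]] lM lN EMN]]].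
  have rL : 0 <= r <= Lb.
    by rewrite r0 (le_trans rs)//; have /andP[] := opp_bound _ sL.
  exists (A + s *: u), (C + r *: w); split => //.
    by split => //; [apply/abP; exists s|apply/cdP; exists r].
  by apply/inK.
have ae_conc : {ae mu, forall l, 0 < l ->
    rho_conc A B C D V l = length_integral A u C w 0 La opp l}.
  have dg : length_density (chords_in (pentagon A B C D V) A B C D) (rho_conc A B C D V).
    exact: xgetI conc_density.
  apply: ae_eq_of_integrals; [exact: dg.1|exact: conc_density.1| |].
    by move=> x _; exact: length_integral_ge0.
  by move=> E mE E0; rewrite dg.2// conc_density.2.
have ae_dist : {ae mu, forall l, `|height A u C w 0| != l}.
  exists [set `|height A u C w 0|].
  split; [exact: measurable_set1|exact: lebesgue_measure_set1|].
  by move=> l /= /negP; rewrite negbK => /eqP.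
apply: (@filterS3 _ _ (ae_filter_ringOfSetsType mu)) ae_conc ae_dist oppS =>
  l concE distE oppS l0.
have {}oppS := oppS l0.
(* Outside [bad] the kernel is continuous at [s], and the segments involved in
   [rho] are not reduced to a point. *)
pose bad : set R := [set 0; La] `|` [set s | chord_length A u C w s 0 ^+ 2 = l ^+ 2]
  `|` [set s | 0 <= s <= La /\ chord_length A u C w s (opp s) ^+ 2 = l ^+ 2]
  `|` [set s | `|height A u C w s| = l].
have fin_bad : finite_set bad.
  rewrite /bad !finite_setU; do !split; try exact: finite_set1.
  - exact: finite_sphere.
  - exact: oppS.
  - have [uw0|uw0] := eqVneq (cross u w) 0.
      rewrite (_ : [set _ | _] = set0); first exact: finite_set0.
      apply/seteqP; split=> // s /=.
      by rewrite height_affine uw0 oppr0 mulr0 addr0 => /eqP; apply/negP.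
    apply: sub_finite_set (finite_tangent A C l uw0) => s /= <-.
    by rewrite real_normK// num_real.
pose kc s := chord_kernel A u C w (strip (opp s)) s l.
have lim_kc s : 0 <= s <= La -> ~ bad s ->
    rho2_quotient u (A + s *: u) C (op (A + s *: u)) l t @[t --> 0^'+] --> kc s.
  move=> sL sb; have /andP[s0 sLa] := sL.
  have sgt0 : 0 < s.
    rewrite lt_neqAle s0 andbT; apply/eqP => s00; apply: sb; left; left; left; left.
    by rewrite -s00.
  have sltL : s < La.
    rewrite lt_neqAle sLa andbT; apply/eqP => sE; apply: sb; left; left; left; right.
    by rewrite sE.
  have ob := opp_bound _ sL.
  have og : 0 < opp s by apply: opp_gt0; rewrite sgt0.
  have mean : t^-1 * \int[mu]_(x in `[s, s + t]) chord_kernel A u C w (strip (opp s)) x l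
      @[t --> 0^'+] --> kc s.
    apply: (@cvg_mean_kernel R A u C w unit_w 0 La e) => //.
    - exact: ltW.
    - by rewrite s0 sltL.
    - by apply/eqP => hE; apply: sb; right.
    - by apply/eqP => hE; apply: sb; left; left; right.
    - by apply/eqP => hE; apply: sb; left; right.
  apply: cvg_trans mean; apply: near_eq_cvg; near=> t.
  have t0 : 0 < t by [].
  have tL : s + t <= La.
    by rewrite -lerBrDl; near: t; apply: nbhs_right_le; rewrite subr_gt0.
  rewrite /rho2_quotient opE// (rhoE unit_u unit_w tr hs)//.
  by rewrite og; case/andP: ob.
have rho2E s : 0 <= s <= La -> ~ bad s -> rho2 u (A + s *: u) C (op (A + s *: u)) l = kc s.
  by move=> sL sb; apply/cvg_lim => //; exact: lim_kc.
pose J : set R := `[0, La]%classic.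
have mJ : measurable J by exact: measurable_itv.
have mkc : measurable_fun J kc.
  by apply: measurable_funTS; exact: measurable_moving_kernel.
have ikc : mu.-integrable J (EFin \o kc).
  exact: (integrable_moving_kernel hs (lexx 0) (lexx La) mopp opp_bound l0).
have mrho2 : measurable_fun J (fun s => rho2 u (A + s *: u) C (op (A + s *: u)) l).
  apply: (measurable_fun_off_finite mJ fin_bad mkc) => s.
  by rewrite /J/= in_itv/=; exact: rho2E.
have cbad : countable bad by exact: finite_set_countable.
have aeE : ae_eq mu J
    (fun s => (rho2 u (A + s *: u) C (op (A + s *: u)) l)%:E) (EFin \o kc).
  exists bad; split; [exact: countable_measurable|exact: countable_lebesgue_measure0|].
  move=> s /= hs'; apply: contrapT => sb; apply: hs'; rewrite /J/= in_itv/= => sJ.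
  by rewrite rho2E.
split.
- exists bad; split; [exact: countable_measurable|exact: countable_lebesgue_measure0|].
  move=> s /= hs'; apply: contrapT => sb; apply: hs' => sJ.
  by apply/cvg_ex; exists (kc s); exact: lim_kc.
- apply/integrableP; split; first exact/measurable_EFinP.
  move/integrableP : ikc => [_]; apply: le_lt_trans.
  rewrite le_eqVlt; apply/orP; left; apply/eqP; apply: ae_eq_integral => //.
  + by apply/measurable_EFinP; exact: measurableT_comp.
  + by apply/measurable_EFinP; exact: measurableT_comp.
  + by apply: filterS aeE => s + sJ => /(_ sJ) sE; exact: (congr1 abse sE).
- rewrite concE// /length_integral /Rintegral; congr fine.
  by apply: ae_eq_integral => //; exact/measurable_EFinP.
Unshelve. all: by end_near. Qed.
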